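(* Let $\mathcal K_\tau$ be a Fréchet operator ideal. Then $\operatorname{Ext}_\tau$ is a contravariant functor from the category of (separable) smooth algebras to the category of abelian groups: for every separable smooth algebra $(A^\infty,A)$ the abelian monoid $\operatorname{Ext}_\tau(A^\infty)$ is an abelian group, and morphisms of smooth algebras induce, functorially and contravariantly, group homomorphisms between these groups by pull-back of extensions.
   Context: Hilbert spaces are complex, separable and infinite-dimensional; $\mathcal L(\mathcal H)$ and $\mathcal K(\mathcal H)$ denote the bounded and the compact operators on $\mathcal H$. A Fréchet operator ideal $\mathcal K_\tau=\mathcal K_\tau(\mathcal H)$ is a two-sided ideal of $\mathcal L(\mathcal H)$ with $\mathcal K_f(\mathcal H)\subset\mathcal K_\tau(\mathcal H)\subset\mathcal K(\mathcal H)$ ($\mathcal K_f$ = finite rank operators), equipped with a Fréchet (complete metrizable locally convex) topology $\tau$ such that the inclusion $\mathcal K_\tau(\mathcal H)\to\mathcal K(\mathcal H)$ is continuous, the map $(S,T,R)\mapsto STR$, $\mathcal L(\mathcal H)\times\mathcal K_\tau(\mathcal H)\times\mathcal L(\mathcal H)\to\mathcal K_\tau(\mathcal H)$, is continuous, and $\mathcal K_f(\mathcal H)$ is dense in $\mathcal K_\tau(\mathcal H)$ (for example, the Schatten ideals $\mathcal L^p$, $1\le p<\infty$). Such an ideal is transported to any other separable infinite-dimensional Hilbert space by a unitary. A smooth algebra is a Fréchet $*$-algebra $A^\infty$ equipped with a norm $p$ satisfying $p(a^*a)=p(a)^2$ for all $a\in A^\infty$; it is written as a pair $(A^\infty,A)$,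 where $A$ is the $C^*$-completion of $A^\infty$ with respect to $p$. The category of smooth algebras has as objects all separable smooth algebras; morphisms are $*$-homomorphisms of Fréchet $*$-algebras that are contractive for the $C^*$-norms (so they extend to the $C^*$-completions). A $\tau$-smooth extension of $(A^\infty,A)$ is a pair $(\pi,P)$, where $\pi$ is a $*$-representation of $A$ on a Hilbert space $\mathcal H$ and $P$ is a projection in $\mathcal L(\mathcal H)$ such that (i) $[\pi(a),P]\in\mathcal K_\tau(\mathcal H)$ for all $a\in A^\infty$, and (ii) $P\pi(A)P\cap\mathcal K(\mathcal H)=\{0\}$. Its associated completely positive map is $\phi(a)=P\pi(a)P$, $a\in A$, regarded as a map into $\mathcal L(P\mathcal H)$. Two $\tau$-smooth extensions are unitarily equivalent if their associated completely positive maps $\phi_1,\phi_2$ are unitarily conjugate up to $\mathcal K_\tau$, i.e. there is a unitary $U$ with $\phi_1(a)-U^*\phi_2(a)U\in\mathcal K_\tau$ for all $a\in A^\infty$. A $\tau$-smooth extension is degenerate if it is unitarily equivalent to a $*$-representation of $A$. $\mathcal E\mathrm{xt}_\tau(A^\infty)$ is the set of unitary equivalence classes of $\tau$-smooth extensions of $A^\infty$; direct sum (using a spatial isomorphism $M_2(\mathcal L(\mathcal H))\simeq\mathcal L(\mathcal H)$) makes it an abelian semigroup. $\operatorname{Ext}_\tau(A^\infty)$ is its quotient abelian monoid modulo degenerate extensions: two classes are identified if they become equal after adding degenerate extensions. For a morphism $f:(B^\infty,B)\to(A^\infty,A)$, pull-back sends $(\pi,P)$ to $(\pi\circ f,P)$.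 *)

(* Defs.v *)
From HB Require Import structures.
From mathcomp Require Import all_boot all_order all_algebra.
From mathcomp Require Import complex.
From mathcomp Require Import all_classical all_reals topology normedtype.

Set Implicit Arguments.
Unset Strict Implicit.
Unset Printing Implicit Defensive.

Import Order.TTheory GRing.Theory Num.Theory.
Import numFieldNormedType.Exports.

Local Open Scope classical_set_scope.
Local Open Scope ring_scope.
Local Open Scope complex_scope.

Section BoundedOperators.
Context {R : realType} {V W : normedModType R[i]}.

Definition bounded_linear (f : V -> W) : Prop :=
  linear f /\ exists M : R, forall x, `|f x| <= M%:C * `|x|.

Definition bounded_linear_pred : {pred V -> W} :=
  fun f => `[< bounded_linear f >].

Record bounded_op := BoundedOp {
  bounded_op_fun :> V -> W ;
  bounded_opP : bounded_op_fun \in bounded_linear_pred }.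

HB.instance Definition _ := [isSub for bounded_op_fun].
HB.instance Definition _ := [Choice of bounded_op by <:].

Lemma bounded_op_linear (f : bounded_op) : linear f.
Proof. by have /asboolP[] := bounded_opP f. Qed.

HB.instance Definition _ (f : bounded_op) :=
  GRing.isLinear.Build R[i] V W *:%R (bounded_op_fun f) (bounded_op_linear f).

Lemma bounded_op_ext (f g : bounded_op) : f =1 g -> f = g.
Proof. by move=> fg; apply/val_inj/funext. Qed.

Lemma Cnorm_Re (U : normedModType R[i]) (x : U) : (complex.Re `|x|)%:C = `|x|.
Proof. by rewrite RRe_real// ger0_real. Qed.

Lemma bounded_op_bound (f : bounded_op) :
  exists2 M : R, 0 <= M & forall x, `|f x| <= M%:C * `|x|.
Proof.
have /asboolP[_ [M fM]] := bounded_opP f.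
exists (Num.max M 0); first by rewrite le_max lexx orbT.
move=> x; apply: le_trans (fM x) _.
by rewrite ler_wpM2r// lecR le_max lexx.
Qed.

Lemma bounded_linear_submod : submod_closed bounded_linear_pred.
Proof.
split=> [|c f g /asboolP[fl [M fM]] /asboolP[gl [N gN]]]; apply/asboolP.
  have z x : (0 : V -> W) x = 0 by [].
  split=> [a x y|]; first by rewrite !z scaler0 addr0.
  by exists 0 => x; rewrite z normr0 mul0r.
have e x : (c *: f + g) x = c *: f x + g x by [].
split=> [a x y|].
  rewrite !e fl gl !scalerDr !scalerA [c * a]mulrC -!addrA.
  by congr (_ + _); rewrite addrCA.
exists (complex.Re `|c| * M + N) => x; rewrite e.
rewrite (le_trans (ler_normD _ _))// normrZ rmorphD rmorphM/= mulrDl.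
rewrite lerD// -mulrA (_ : (complex.Re `|c|)%:C = `|c|) ?ler_wpM2l//.
Qed.

HB.instance Definition _ := GRing.isSubmodClosed.Build R[i] (V -> W)
  bounded_linear_pred (GRing.submod_closed_semi bounded_linear_submod).
HB.instance Definition _ := [SubChoice_isSubLmodule of bounded_op by <:].

Definition opnorm (f : bounded_op) : R :=
  inf [set M : R | 0 <= M /\ forall x, `|f x| <= M%:C * `|x|].

Let has_inf_opnorm (f : bounded_op) :
  has_inf [set M : R | 0 <= M /\ forall x, `|f x| <= M%:C * `|x|].
Proof.
split; last by exists 0 => M [].
by have [M M0 fM] := bounded_op_bound f; exists M.
Qed.

Lemma opnorm_ge0 (f : bounded_op) : 0 <= opnorm f.
Proof.
apply: lb_le_inf; last by move=> M [].
by have [] := has_inf_opnorm f.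
Qed.

Lemma opnorm_le (f : bounded_op) (M : R) :
  0 <= M -> (forall x, `|f x| <= M%:C * `|x|) -> opnorm f <= M.
Proof. by move=> M0 fM; apply: ge_inf => //; have [] := has_inf_opnorm f. Qed.

Lemma le_opnorm (f : bounded_op) x : `|f x| <= (opnorm f)%:C * `|x|.
Proof.
have [->|x0] := eqVneq x 0; first by rewrite linear0 !normr0 mulr0.
have nx : 0 < `|x| by rewrite normr_gt0.
rewrite -ler_pdivrMr//.
have -> : `|f x| / `|x| = (complex.Re `|f x| / complex.Re `|x|)%:C.
  by rewrite fmorph_div/= !Cnorm_Re.
have Rx : 0 < complex.Re `|x| by rewrite -(@ltcR R) Cnorm_Re.
rewrite lecR; apply: lb_le_inf; first by have [] := has_inf_opnorm f.
by move=> M [M0 fM]; rewrite ler_pdivrMr// -(@lecR R) rmorphM/= !Cnorm_Re.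
Qed.

Let bop_norm (f : bounded_op) : R[i] := (opnorm f)%:C.

Let bop_normD f g : bop_norm (f + g) <= bop_norm f + bop_norm g.
Proof.
rewrite /bop_norm -rmorphD lecR; apply: opnorm_le => [|x].
  by rewrite addr_ge0// opnorm_ge0.
rewrite rmorphD/= mulrDl (le_trans (ler_normD _ _))//.
by rewrite lerD// le_opnorm.
Qed.

Let bop_normZ c f : bop_norm (c *: f) = `|c| * bop_norm f.
Proof.
have le1 a h : opnorm (a *: h) <= complex.Re `|a| * opnorm h.
  have ReN : (complex.Re `|a|)%:C = `|a| by rewrite RRe_real// ger0_real.
  apply: opnorm_le => [|x].
    by rewrite mulr_ge0 ?opnorm_ge0// -ler0c ReN.
  by rewrite rmorphM/= ReN normrZ -mulrA ler_wpM2l// le_opnorm.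
have ReN a : (complex.Re `|a : R[i]|)%:C = `|a| by rewrite RRe_real// ger0_real.
apply: le_anti; apply/andP; split; first by rewrite -ReN -rmorphM/= lecR.
have [->|c0] := eqVneq c 0; first by rewrite normr0 mul0r ler0c opnorm_ge0.
have c1 : 0 < `|c| by rewrite normr_gt0.
rewrite -ler_pdivlMl// -normfV -ReN -rmorphM/= lecR.
by rewrite -{1}(scalerK c0 f).
Qed.

Let bop_norm0_eq0 f : bop_norm f = 0 -> f = 0.
Proof.
rewrite /bop_norm => -[f0].
apply: bounded_op_ext => x; apply/eqP; rewrite -normr_le0.
by rewrite (le_trans (le_opnorm f x))// f0 mul0r.
Qed.

HB.instance Definition _ :=
  @Lmodule_isNormed.Build R[i] bounded_op bop_norm bop_normD bop_normZ
    bop_norm0_eq0.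

End BoundedOperators.
Arguments bounded_op {R} V W.
Arguments BoundedOp {R V W}.

Lemma bounded_opE (R : realType) (V W : normedModType R[i])
  (f : bounded_op V W) : `|f| = (opnorm f)%:C.
Proof. by []. Qed.

Section Composition.
Context {R : realType}.
Implicit Types V W X : normedModType R[i].

Lemma op_id_subproof V : (id : V -> V) \in bounded_linear_pred.
Proof.
by apply/asboolP; split=> //; exists 1 => x; rewrite mul1r.
Qed.

Definition op_id V : bounded_op V V := BoundedOp id (op_id_subproof V).

Lemma op_comp_subproof V W X (S : bounded_op W X) (T : bounded_op V W) :
  (S \o T : V -> X) \in bounded_linear_pred.
Proof.
apply/asboolP; split=> [c x y|]; first by rewrite /= !linearP.
have [M M0 SM] := bounded_op_bound S; have [N N0 TN] := bounded_op_bound T.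
exists (M * N) => x /=; rewrite (le_trans (SM _))// rmorphM/= -mulrA.
by rewrite ler_wpM2l// ler0c.
Qed.

Definition op_comp V W X (S : bounded_op W X) (T : bounded_op V W) :
  bounded_op V X := BoundedOp (S \o T) (op_comp_subproof S T).

Lemma op_continuous V W (T : bounded_op V W) :
  continuous T.
Proof.
apply: bounded_linear_continuous; apply/linear_boundedP.
have [M M0 TM] := bounded_op_bound T; near=> r => x.
rewrite (le_trans (TM x))// ler_wpM2r//; near: r.
by apply: nbhs_pinfty_ge; rewrite ger0_real// ler0c.
Unshelve. all: by end_near. Qed.

End Composition.
Arguments op_id {R V}.

Notation "S \bo T" := (op_comp S T)
  (at level 40, left associativity, format "S  \bo  T") : ring_scope.

Section OperatorClasses.
Context {R : realType} {V W : normedModType R[i]}.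

Definition finite_rank (T : bounded_op V W) : Prop :=
  exists (n : nat) (e : 'I_n -> W),
    forall x, exists c : 'I_n -> R[i], T x = \sum_(i < n) c i *: e i.

Definition compact_op (T : bounded_op V W) : Prop :=
  precompact (T @` [set x | `|x| <= 1]).

End OperatorClasses.

Definition separable_space (T : topologicalType) : Prop :=
  exists2 S : set T, countable S & dense S.

Definition infinite_dimensional (R : realType) (V : lmodType R[i]) : Prop :=
  forall (n : nat) (e : 'I_n -> V),
    exists x, forall c : 'I_n -> R[i], x <> \sum_(i < n) c i *: e i.

HB.mixin Record CompleteNormedModule_isHilbert (R : realType) H
    & CompleteNormedModule R[i] H := {
  ip : H -> H -> R[i] ;
  ipDl : forall x y z, ip (x + y) z = ip x z + ip y z ;
  ipZl : forall c x y, ip (c *: x) y = c * ip x y ;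
  ipC : forall x y, ip y x = Num.conj (ip x y) ;
  ip_norm : forall x, ip x x = `|x| ^+ 2 }.

#[short(type="hilbertType")]
HB.structure Definition Hilbert (R : realType) :=
  {H of CompleteNormedModule R[i] H & CompleteNormedModule_isHilbert R H}.

Definition separable_infinite_dimensional (R : realType) (H : hilbertType R) :
  Prop := separable_space H /\ infinite_dimensional H.

Section HilbertOperators.
Context {R : realType}.
Implicit Types H K : hilbertType R.

Definition is_adjoint H K (T : bounded_op H K) (T' : bounded_op K H) : Prop :=
  forall x y, ip (T x) y = ip x (T' y).

Record unitary H K := Unitary {
  unitary_op :> bounded_op H K ;
  unitary_adj : bounded_op K H ;
  unitary_adjP : is_adjoint unitary_op unitary_adj ;
  unitary_adjK : unitary_adj \bo unitary_op = op_id ;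
  unitary_Kadj : unitary_op \bo unitary_adj = op_id }.

Record projection H := Projection {
  projection_op :> bounded_op H H ;
  projection_idem : projection_op \bo projection_op = projection_op ;
  projection_sa : is_adjoint projection_op projection_op }.

End HilbertOperators.

Section ProjectionRange.
Context {R : realType} {H : hilbertType R} (P : projection H).

Definition range_pred : {pred H} := fun x => P x == x.

Record proj_range := ProjRange {
  proj_range_val :> H ;
  proj_rangeP : proj_range_val \in range_pred }.

HB.instance Definition _ := [isSub for proj_range_val].
HB.instance Definition _ := [Choice of proj_range by <:].

Lemma range_submod : submod_closed range_pred.
Proof.
split=> [|c x y /eqP Px /eqP Py]; first by rewrite unfold_in linear0.
by rewrite unfold_in linearP/= Px Py.
Qed.

HB.instance Definition _ := GRing.isSubmodClosed.Build R[i] H range_pred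
  (GRing.submod_closed_semi range_submod).
HB.instance Definition _ := [SubChoice_isSubLmodule of proj_range by <:].

Let range_norm (x : proj_range) : R[i] := `|val x|.

Let range_normD x y : range_norm (x + y) <= range_norm x + range_norm y.
Proof. exact: ler_normD. Qed.

Let range_normZ c x : range_norm (c *: x) = `|c| * range_norm x.
Proof. exact: normrZ. Qed.

Let range_norm0_eq0 x : range_norm x = 0 -> x = 0.
Proof. by move=> /normr0_eq0 x0; apply: val_inj. Qed.

HB.instance Definition _ := @Lmodule_isNormed.Build R[i] proj_range
  range_norm range_normD range_normZ range_norm0_eq0.

Lemma proj_rangeE (x : proj_range) : P (val x) = val x.
Proof. exact: eqP (proj_rangeP x). Qed.

Lemma proj_range_fix (x : H) : P x \in range_pred.
Proof.
by rewrite unfold_in -[X in X == _]/((P \bo P) x) projection_idem.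
Qed.

Lemma range_normE (x : proj_range) : `|x| = `|val x|. Proof. by []. Qed.

Let range_complete (F : set_system proj_range) :
  ProperFilter F -> cauchy F -> cvg F.
Proof.
move=> FF Fc.
have vFc : cauchy (val @ F).
  apply/cauchy_ballP => e e0; have /cauchy_ballP/(_ e e0) := Fc.
  move=> [[A B] /= [FA FB] AB].
  exists (val @` A, val @` B) => /=.
    by split; [apply: filterS FA|apply: filterS FB] => x Ax; exists x.
  move=> [x y]/= [[u Au <-] [v Bv <-]].
  by have := AB (u, v) (conj Au Bv); rewrite -!ball_normE.
have /cvg_ex[h Fh] : cvg (val @ F) by exact: cauchy_cvg.
have Ph : P h = h.
  have : (P \o val) @ F --> P h.
    apply: continuous_cvg => //; exact: op_continuous.
  rewrite (_ : P \o val = val); last by apply/funext => x /=; rewrite proj_rangeE.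
  by move=> FPh; apply: (cvg_unique _ FPh Fh).
have hP : h \in range_pred by rewrite unfold_in Ph.
apply/cvg_ex; exists (ProjRange hP).
by apply/cvgrPdist_lt => e e0; move/cvgrPdist_lt: Fh => /(_ e e0).
Qed.

HB.instance Definition _ := Uniform_isComplete.Build proj_range range_complete.

Let range_ip (x y : proj_range) : R[i] := ip (val x) (val y).

Let range_ipDl x y z : range_ip (x + y) z = range_ip x z + range_ip y z.
Proof. exact: ipDl. Qed.

Let range_ipZl c x y : range_ip (c *: x) y = c * range_ip x y.
Proof. exact: ipZl. Qed.

Let range_ipC x y : range_ip y x = Num.conj (range_ip x y).
Proof. exact: ipC. Qed.

Let range_ip_norm x : range_ip x x = `|x| ^+ 2.
Proof. exact: ip_norm. Qed.

HB.instance Definition _ := @CompleteNormedModule_isHilbert.Build R proj_range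
  range_ip range_ipDl range_ipZl range_ipC range_ip_norm.

End ProjectionRange.
Arguments ProjRange {R H}.

(** The Hilbert space direct sum; the alias hides the max norm of H * K *)

Definition dsum (R : realType) (H K : hilbertType R) : Type := (H * K)%type.

Section DirectSum.
Context {R : realType} (H K : hilbertType R).
Local Notation S := (dsum H K).

HB.instance Definition _ := GRing.Lmodule.copy S (H * K)%type.

Let dsum_norm (x : S) : R[i] := sqrtC (`|x.1| ^+ 2 + `|x.2| ^+ 2).

Let dsum_norm_ge0 (x : S) : 0 <= `|x.1| ^+ 2 + `|x.2| ^+ 2 :> R[i].
Proof. by rewrite addr_ge0// exprn_ge0. Qed.

Let dsum_normE (x : S) :
  dsum_norm x = `|complex.Re `|x.1| +i* complex.Re `|x.2| |.
Proof.
apply/eqP; rewrite -(@eqrXn2 _ 2)// ?sqrtC_ge0// sqrtCK -add_Re2_Im2/=.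
by rewrite rmorphD !rmorphXn/= !Cnorm_Re.
Qed.

Let norm_mono (a b c d : R) : 0 <= a -> 0 <= b -> a <= c -> b <= d ->
  `|a +i* b| <= `|c +i* d|.
Proof.
move=> a0 b0 ac bd; rewrite !normc_def lecR ler_sqrt/=; last first.
  by rewrite addr_ge0// sqr_ge0.
by rewrite lerD// ler_sqr// nnegrE// (le_trans _ ac, le_trans _ bd).
Qed.

Let ReN_ge0 (V : normedModType R[i]) (x : V) : 0 <= complex.Re `|x|.
Proof. by rewrite -ler0c Cnorm_Re. Qed.

Let ReN_leD (V : normedModType R[i]) (x y : V) :
  complex.Re `|x + y| <= complex.Re `|x| + complex.Re `|y|.
Proof. by rewrite -(@lecR R) rmorphD/= !Cnorm_Re ler_normD. Qed.

Let dsum_normD x y : dsum_norm (x + y) <= dsum_norm x + dsum_norm y.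
Proof.
rewrite !dsum_normE; apply: le_trans (ler_normD _ _).
by apply: norm_mono; rewrite ?ReN_ge0 ?ReN_leD.
Qed.

Let dsum_normZ c x : dsum_norm (c *: x) = `|c| * dsum_norm x.
Proof.
rewrite /dsum_norm /= !normrZ !exprMn -mulrDr rootCMl ?exprn_ge0//.
by rewrite sqrCK.
Qed.

Let dsum_norm0_eq0 x : dsum_norm x = 0 -> x = 0.
Proof.
move=> /eqP; rewrite sqrtC_eq0 paddr_eq0 ?exprn_ge0// !expf_eq0/= !normr_eq0.
by case: x => x1 x2 /= /andP[/eqP-> /eqP->].
Qed.

HB.instance Definition _ := @Lmodule_isNormed.Build R[i] S
  dsum_norm dsum_normD dsum_normZ dsum_norm0_eq0.

Lemma dsum_normrE (x : S) : `|x| = sqrtC (`|x.1| ^+ 2 + `|x.2| ^+ 2).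
Proof. by []. Qed.

Lemma dsum_sqr_norm (x : S) : `|x| ^+ 2 = `|x.1| ^+ 2 + `|x.2| ^+ 2.
Proof. by rewrite dsum_normrE sqrtCK. Qed.

Lemma dsum_norm_fst (x : S) : `|x.1| <= `|x|.
Proof.
by rewrite -(@ler_pXn2r _ 2)// ?nnegrE// dsum_sqr_norm lerDl exprn_ge0.
Qed.

Lemma dsum_norm_snd (x : S) : `|x.2| <= `|x|.
Proof.
by rewrite -(@ler_pXn2r _ 2)// ?nnegrE// dsum_sqr_norm lerDr exprn_ge0.
Qed.

Lemma dsum_norm_le (x : S) : `|x| <= `|x.1| + `|x.2|.
Proof.
rewrite -(@ler_pXn2r _ 2)// ?nnegrE ?addr_ge0// dsum_sqr_norm sqrrD.
by rewrite addrAC lerDl mulrn_wge0// mulr_ge0.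
Qed.

Let dsum_complete (F : set_system S) : ProperFilter F -> cauchy F -> cvg F.
Proof.
move=> FF /cauchy_ballP Fc.
have fc : cauchy (fst @ F).
  apply/cauchy_ballP => e e0; have [[A B] /= [FA FB] AB] := Fc e e0.
  exists (fst @` A, fst @` B) => /=.
    by split; [apply: filterS FA|apply: filterS FB] => x Ax; exists x.
  move=> [x y]/= [[u Au <-] [v Bv <-]].
  have := AB (u, v) (conj Au Bv); rewrite -!ball_normE/=.
  exact: le_lt_trans (dsum_norm_fst (u - v)).
have sc : cauchy (snd @ F).
  apply/cauchy_ballP => e e0; have [[A B] /= [FA FB] AB] := Fc e e0.
  exists (snd @` A, snd @` B) => /=.
    by split; [apply: filterS FA|apply: filterS FB] => x Ax; exists x.
  move=> [x y]/= [[u Au <-] [v Bv <-]].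
  have := AB (u, v) (conj Au Bv); rewrite -!ball_normE/=.
  exact: le_lt_trans (dsum_norm_snd (u - v)).
have /cvg_ex[h Fh] : cvg (fst @ F) by exact: cauchy_cvg.
have /cvg_ex[k Fk] : cvg (snd @ F) by exact: cauchy_cvg.
apply/cvg_ex; exists ((h, k) : S); apply/cvgrPdist_lt => e e0.
have e2 : 0 < e / 2 by rewrite divr_gt0.
move/cvgrPdist_lt: Fh => /(_ _ e2) Fh; move/cvgrPdist_lt: Fk => /(_ _ e2) Fk.
near=> x; apply: le_lt_trans (dsum_norm_le _) _.
by rewrite [e]splitr ltrD//; near: x.
Unshelve. all: by end_near. Qed.

HB.instance Definition _ := Uniform_isComplete.Build S dsum_complete.

Let dsum_ip (x y : S) : R[i] := ip x.1 y.1 + ip x.2 y.2.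

Let dsum_ipDl x y z : dsum_ip (x + y) z = dsum_ip x z + dsum_ip y z.
Proof. by rewrite /dsum_ip !ipDl addrACA. Qed.

Let dsum_ipZl c x y : dsum_ip (c *: x) y = c * dsum_ip x y.
Proof. by rewrite /dsum_ip !ipZl mulrDr. Qed.

Let dsum_ipC x y : dsum_ip y x = Num.conj (dsum_ip x y).
Proof. by rewrite /dsum_ip rmorphD/= -!ipC. Qed.

Let dsum_ip_norm x : dsum_ip x x = `|x| ^+ 2.
Proof. by rewrite /dsum_ip !ip_norm dsum_sqr_norm. Qed.

HB.instance Definition _ := @CompleteNormedModule_isHilbert.Build R S
  dsum_ip dsum_ipDl dsum_ipZl dsum_ipC dsum_ip_norm.

End DirectSum.

Section DirectSumOperators.
Context {R : realType} {H K : hilbertType R}.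

Definition dsum_fun (S : H -> H) (T : K -> K) (x : dsum H K) : dsum H K :=
  (S x.1, T x.2).

Lemma op_dsum_subproof (S : bounded_op H H) (T : bounded_op K K) :
  dsum_fun S T \in bounded_linear_pred.
Proof.
apply/asboolP; split=> [c x y|].
  by rewrite /dsum_fun /= !linearP.
have [M M0 SM] := bounded_op_bound S; have [N N0 TN] := bounded_op_bound T.
exists (M + N) => x; rewrite (le_trans (dsum_norm_le _))//=.
rewrite rmorphD mulrDl lerD//.
  by rewrite (le_trans (SM _))// ler_wpM2l ?ler0c// dsum_norm_fst.
by rewrite (le_trans (TN _))// ler_wpM2l ?ler0c// dsum_norm_snd.
Qed.

Definition op_dsum (S : bounded_op H H) (T : bounded_op K K) :
  bounded_op (dsum H K) (dsum H K) :=
  BoundedOp (dsum_fun S T) (op_dsum_subproof S T).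

Lemma proj_dsum_idem (P : projection H) (Q : projection K) :
  op_dsum P Q \bo op_dsum P Q = op_dsum P Q.
Proof.
apply: bounded_op_ext => x; rewrite /= /dsum_fun /=.
rewrite -[P (P _)]/((P \bo P) _) -[Q (Q _)]/((Q \bo Q) _).
by rewrite !projection_idem.
Qed.

Lemma proj_dsum_sa (P : projection H) (Q : projection K) :
  is_adjoint (op_dsum P Q) (op_dsum P Q).
Proof. by move=> x y; congr (_ + _); exact: projection_sa. Qed.

Definition proj_dsum (P : projection H) (Q : projection K) :
  projection (dsum H K) := Projection (proj_dsum_idem P Q) (proj_dsum_sa P Q).

End DirectSumOperators.

(** The uniform structure carried by a tvsType is only required
    to induce the topology, so completeness is stated for the translation
    invariant uniformity. *)

Definition metrizable (R : realType) (T : topologicalType) : Prop :=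
  exists d : T -> T -> R,
    [/\ forall x y, d x y = 0 <-> x = y,
        forall x y, d x y = d y x,
        forall x y z, d x z <= d x y + d y z &
        forall x (U : set T),
          nbhs x U <-> exists2 e, 0 < e & [set y | d x y < e] `<=` U].

Definition tvs_cauchy (K : numDomainType) (E : tvsType K) (F : set_system E) :
  Prop :=
  forall U : set E, nbhs 0 U ->
    exists2 A, F A & forall x y, A x -> A y -> U (x - y).

Definition tvs_complete (K : numDomainType) (E : tvsType K) : Prop :=
  forall F : set_system E, ProperFilter F -> tvs_cauchy F ->
    exists l : E, F --> l.

HB.mixin Record Tvs_isFrechet (R : realType) E & Tvs R[i] E := {
  frechet_metrizable : metrizable R E ;
  frechet_complete : @tvs_complete R[i] E }.

#[short(type="frechetType")]
HB.structure Definition Frechet (R : realType) :=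
  {E of Tvs R[i] E & Tvs_isFrechet R E}.

Record frechet_ideal (R : realType) (H : hilbertType R) := FrechetIdeal {
  ideal_sort :> frechetType R ;
  (* the inclusion of the ideal into the bounded operators; its topology is not
     the subspace topology *)
  ideal_op : ideal_sort -> bounded_op H H ;
  ideal_op_linear : linear ideal_op ;
  ideal_op_inj : injective ideal_op ;
  ideal_mul : bounded_op H H -> ideal_sort -> bounded_op H H -> ideal_sort ;
  ideal_mulE : forall S T Q,
    ideal_op (ideal_mul S T Q) = S \bo ideal_op T \bo Q ;
  ideal_finite_rank : [set T | finite_rank T] `<=` range ideal_op ;
  ideal_compact : range ideal_op `<=` [set T | compact_op T] ;
  ideal_op_continuous : continuous ideal_op ;
  ideal_mul_continuous :
    continuous (fun t : bounded_op H H * ideal_sort * bounded_op H H =>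
      ideal_mul t.1.1 t.1.2 t.2) ;
  ideal_dense : dense [set T | finite_rank (ideal_op T)] }.

(** Membership in the ideal transported to a Hilbert space H' by a unitary; by
    the ideal property the choice of the unitary is irrelevant. *)
Definition in_ideal (R : realType) (H : hilbertType R) (K : frechet_ideal H)
    (H' : hilbertType R) (T : bounded_op H' H') : Prop :=
  exists U : unitary H' H, range (ideal_op (f := K)) (U \bo T \bo unitary_adj U).

(** Star algebras are not assumed unital, so the ring structures of the library
    do not apply. *)

HB.mixin Record Lmodule_isStarAlgebra (R : realType) A & GRing.Lmodule R[i] A :=
{
  amul : A -> A -> A ;
  star : A -> A ;
  amulA : associative amul ;
  amulDl : left_distributive amul +%R ;
  amulDr : right_distributive amul +%R ;
  amulZl : forall c a b, amul (c *: a) b = c *: amul a b ;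
  amulZr : forall c a b, amul a (c *: b) = c *: amul a b ;
  starD : {morph star : a b / a + b} ;
  starZ : forall c a, star (c *: a) = Num.conj c *: star a ;
  starM : forall a b, star (amul a b) = amul (star b) (star a) ;
  starK : involutive star }.

#[short(type="starAlgType")]
HB.structure Definition StarAlgebra (R : realType) :=
  {A of GRing.Lmodule R[i] A & Lmodule_isStarAlgebra R A}.

HB.structure Definition TvsStarAlgebra (R : realType) :=
  {A of Tvs R[i] A & StarAlgebra R A}.

HB.mixin Record StarAlgebra_isFrechetStarAlgebra (R : realType) A
    & Frechet R A & StarAlgebra R A := {
  amul_continuous : continuous (fun t : A * A => amul t.1 t.2) ;
  star_continuous : continuous (star : A -> A) }.

#[short(type="frechetStarAlgType")]
HB.structure Definition FrechetStarAlgebra (R : realType) :=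
  {A of Frechet R A & StarAlgebra R A & StarAlgebra_isFrechetStarAlgebra R A}.

HB.mixin Record StarAlgebra_isCstarAlgebra (R : realType) A
    & CompleteNormedModule R[i] A & StarAlgebra R A := {
  cstar_normM : forall a b : A, `|amul a b| <= `|a| * `|b| ;
  cstar_identity : forall a : A, `|amul (star a) a| = `|a| ^+ 2 }.

#[short(type="cstarAlgType")]
HB.structure Definition CstarAlgebra (R : realType) :=
  {A of CompleteNormedModule R[i] A & StarAlgebra R A
      & StarAlgebra_isCstarAlgebra R A}.

Definition star_hom (R : realType) (A B : starAlgType R) (f : A -> B) : Prop :=
  [/\ linear f, {morph f : a b / amul a b} & {morph f : a / star a}].

Record star_rep (R : realType) (A : cstarAlgType R) (H : hilbertType R) :=
StarRep {
  rep_fun :> A -> bounded_op H H ;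
  rep_linear : linear rep_fun ;
  repM : forall a b, rep_fun (amul a b) = rep_fun a \bo rep_fun b ;
  repS : forall a, is_adjoint (rep_fun a) (rep_fun (star a)) }.

(** A smooth algebra consists of a Frechet star algebra, a norm p on it, and the
    completion with respect to p: a C*-algebra with a dense isometric embedding. *)
Record smooth_algebra (R : realType) := SmoothAlgebra {
  smooth_sort :> frechetStarAlgType R ;
  smooth_norm : smooth_sort -> R ;
  smooth_normD : forall a b,
    smooth_norm (a + b) <= smooth_norm a + smooth_norm b ;
  smooth_normZ : forall (c : R[i]) a,
    (smooth_norm (c *: a))%:C = `|c| * (smooth_norm a)%:C ;
  smooth_norm0_eq0 : forall a, smooth_norm a = 0 -> a = 0 ;
  smooth_norm_cstar : forall a,
    smooth_norm (amul (star a) a) = smooth_norm a ^+ 2 ;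
  smooth_cstar : cstarAlgType R ;
  smooth_incl : smooth_sort -> smooth_cstar ;
  smooth_incl_hom : star_hom smooth_incl ;
  smooth_incl_norm : forall a, `|smooth_incl a| = (smooth_norm a)%:C ;
  smooth_incl_dense : dense (range smooth_incl) }.

Record smooth_hom (R : realType) (B A : smooth_algebra R) := SmoothHom {
  smooth_hom_fun :> B -> A ;
  smooth_hom_star : star_hom smooth_hom_fun ;
  smooth_hom_continuous : continuous smooth_hom_fun ;
  smooth_hom_contractive : forall b,
    smooth_norm (smooth_hom_fun b) <= smooth_norm b }.

Section SmoothCategory.
Context {R : realType}.
Implicit Types A B C : smooth_algebra R.

Lemma smooth_id_star A : star_hom (id : A -> A).
Proof. by []. Qed.

Definition smooth_id A : smooth_hom A A :=
  SmoothHom (smooth_id_star A) (fun x => cvg_id) (fun a => lexx _).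

Lemma smooth_comp_star A B C (f : smooth_hom B A) (g : smooth_hom C B) :
  star_hom (f \o g).
Proof.
have [fl fM fS] := smooth_hom_star f; have [gl gM gS] := smooth_hom_star g.
by split=> [c a b|a b|a] /=; rewrite ?gl ?fl ?gM ?fM ?gS ?fS.
Qed.

Lemma smooth_comp_continuous A B C (f : smooth_hom B A) (g : smooth_hom C B) :
  continuous (f \o g).
Proof.
move=> x U fgU; have := @smooth_hom_continuous _ _ _ f (g x) U fgU.
exact: (@smooth_hom_continuous _ _ _ g x).
Qed.

Lemma smooth_comp_contractive A B C (f : smooth_hom B A) (g : smooth_hom C B) c :
  smooth_norm ((f \o g) c) <= smooth_norm c.
Proof.
exact: le_trans (smooth_hom_contractive f _) (smooth_hom_contractive g _).
Qed.

Definition smooth_comp A B C (f : smooth_hom B A) (g : smooth_hom C B) :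
  smooth_hom C A :=
  SmoothHom (smooth_comp_star f g) (@smooth_comp_continuous _ _ _ f g)
    (smooth_comp_contractive f g).

End SmoothCategory.

Section CstarContinuity.
Context {R : realType} {A : cstarAlgType R}.

Lemma star0 : star (0 : A) = 0.
Proof. by have := starZ 0 (0 : A); rewrite conjC0 !scale0r. Qed.

Lemma starB (a b : A) : star (a - b) = star a - star b.
Proof. by rewrite starD -scaleN1r starZ rmorphN1 scaleN1r. Qed.

Lemma cstar_norm_star (a : A) : `|star a| = `|a|.
Proof.
suff le b : `|b : A| <= `|star b|.
  by apply/le_anti/andP; split; rewrite ?le// -{2}(starK a) le.
have [->|b0] := eqVneq b 0; first by rewrite normr0.
have bp : 0 < `|b| by rewrite normr_gt0.
by rewrite -(ler_pM2r bp) -expr2 -cstar_identity cstar_normM.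
Qed.

Lemma cstar_star_continuous : continuous (star : A -> A).
Proof.
move=> a; apply/cvgrPdist_lt => e e0; near=> b.
rewrite -starB cstar_norm_star; near: b.
by move: e e0; apply/cvgrPdist_lt; exact: cvg_id.
Unshelve. all: by end_near. Qed.

Lemma cstar_amul_continuous : continuous (fun t : A * A => amul t.1 t.2).
Proof.
move=> [a b]; apply/cvgrPdist_lt => /= e e0.
pose M : R[i] := `|a| + 1 + `|b|.
have M0 : 0 < M by rewrite ltr_wpDr// ltr_wpDl.
pose d := Num.min (complex.Re (e / (M + M))) 1.
have eM : 0 < e / (M + M) by rewrite divr_gt0// addr_gt0.
have d0 : 0 < d%:C.
  by rewrite ltcR lt_min ltr01 andbT -(@ltcR R) RRe_real// gtr0_real.
have d1 : d%:C <= 1 by rewrite (_ : 1 = 1%:C)// lecR ge_min lexx orbT.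
have de : d%:C <= e / (M + M).
  by rewrite -[leRHS]RRe_real ?gtr0_real// lecR ge_min lexx.
have e2 : e = e / (M + M) * M + e / (M + M) * M.
  by rewrite -mulrDr divfK// gt_eqF// addr_gt0.
exists (ball a d%:C, ball b d%:C); first by split; exact: nbhsx_ballx.
move=> [x y] /= []; rewrite -!ball_normE/= => ax By.
have -> : amul a b - amul x y = amul (a - x) b + amul x (b - y).
  have aN u v : amul (- u : A) v = - amul u v.
    by rewrite -scaleN1r amulZl scaleN1r.
  have aN' u v : amul (u : A) (- v) = - amul u v.
    by rewrite -scaleN1r amulZr scaleN1r.
  by rewrite amulDl amulDr aN aN' addrA subrK.
have nx : `|x| <= `|a| + 1.
  rewrite -[x](subKr a) (le_trans (ler_normB _ _))// lerD//.
  by rewrite (le_trans (ltW ax)).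
rewrite (le_lt_trans (ler_normD _ _))// e2.
apply: ler_ltD.
  rewrite (le_trans (cstar_normM _ _))// ler_pM//.
    by rewrite (le_trans (ltW ax)).
  by rewrite lerDr addr_ge0.
rewrite (le_lt_trans (cstar_normM _ _))// mulrC.
have M1 : `|a| + 1 <= M by rewrite lerDl.
apply: le_lt_trans (_ : `|b - y| * M < _).
  by rewrite ler_wpM2l// (le_trans nx).
by rewrite ltr_pM2r// (lt_le_trans By).
Qed.

End CstarContinuity.

(** The extension of a morphism to the C*-completions: its graph is the closure
    of the graph of the morphism. *)

Section CompletionExtension.
Context {R : realType} {B A : smooth_algebra R} (f : smooth_hom B A).
Local Notation iB := (@smooth_incl R B).
Local Notation iA := (@smooth_incl R A).

Definition completion_graph : set (smooth_cstar B * smooth_cstar A) :=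
  closure [set (iB c, iA (f c)) | c in setT].

Definition completion_ext (b : smooth_cstar B) : smooth_cstar A :=
  get [set a | completion_graph (b, a)].

Let iBl : linear iB. Proof. by have [] := smooth_incl_hom B. Qed.
Let iAl : linear iA. Proof. by have [] := smooth_incl_hom A. Qed.
Let fl : linear f. Proof. by have [] := smooth_hom_star f. Qed.

Let iBB c d : iB (c - d) = iB c - iB d.
Proof. by rewrite addrC -scaleN1r iBl scaleN1r addrC. Qed.

Let iAB c d : iA (f (c - d)) = iA (f c) - iA (f d).
Proof. by rewrite addrC -scaleN1r fl iAl scaleN1r addrC. Qed.

Let contr c d : `|iA (f c) - iA (f d)| <= `|iB c - iB d|.
Proof.
by rewrite -iAB -iBB !smooth_incl_norm lecR smooth_hom_contractive.
Qed.

Lemma completion_graph_ball b a (e : R[i]) : 0 < e -> completion_graph (b, a) ->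
  exists c, `|b - iB c| < e /\ `|a - iA (f c)| < e.
Proof.
move=> e0 /(_ (ball b e `*` ball a e)) []; first exact: nbhsx_ballx.
move=> _ [[c _ <-]] []; rewrite -!ball_normE /= => h1 h2; by exists c.
Qed.

Lemma completion_graph_contr b a b' a' :
  completion_graph (b, a) -> completion_graph (b', a') ->
  `|a - a'| <= `|b - b'|.
Proof.
move=> ba ba'; apply/ler_addgt0Pr => e e0.
have e4 : 0 < e / 2 / 2 by rewrite !divr_gt0.
have [c [bc ac]] := completion_graph_ball e4 ba.
have [d [bd ad]] := completion_graph_ball e4 ba'.
have -> : a - a' = (a - iA (f c)) + (iA (f c) - iA (f d)) - (a' - iA (f d)).
  by rewrite addrA subrK opprB addrA subrK.
rewrite (le_trans (ler_normB _ _))//.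
rewrite (le_trans (lerD (ler_normD _ _) (lexx _)))//.
have bb : `|iB c - iB d| <= `|b - b'| + (e / 2).
  have -> : iB c - iB d = (b - b') - (b - iB c) + (b' - iB d).
    by rewrite opprB [b - b' + _]addrC !addrA !subrK.
  rewrite (le_trans (ler_normD _ _))// (le_trans (lerD (ler_normB _ _) (lexx _)))//.
  by rewrite -addrA lerD// [e / 2]splitr lerD// ltW.
rewrite [e in leRHS]splitr [X in _ + (X + _)]splitr.
have -> : `|b - b'| + (e / 2 / 2 + e / 2 / 2 + e / 2) =
   e / 2 / 2 + (`|b - b'| + e / 2) + e / 2 / 2.
  by rewrite addrCA -!addrA; congr (_ + _); rewrite addrCA; congr (_ + _);
     rewrite addrC.
by rewrite !lerD ?(ltW ac) ?(ltW ad)// (le_trans (contr _ _)).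
Qed.

Lemma completion_graph_fun b a a' :
  completion_graph (b, a) -> completion_graph (b, a') -> a = a'.
Proof.
move=> ba ba'; apply/eqP; rewrite -subr_eq0 -normr_le0.
by rewrite (le_trans (completion_graph_contr ba ba'))// subrr normr0.
Qed.

Lemma completion_graph_total b : exists a, completion_graph (b, a).
Proof.
pose G (e : R[i]) := [set iA (f c) | c in [set c | `|b - iB c| < e]].
pose F := filter_from [set e : R[i] | 0 < e] G.
have FF : ProperFilter F.
  apply: filter_from_proper; last first.
    move=> e e0; have [] := @smooth_incl_dense R B (ball b e).
    - by exists b; exact: ballxx.
    - exact: ball_open.
    move=> x [bx [c _ cx]]; move: bx; rewrite -cx -ball_normE /= => bc.
    by exists (iA (f c)); exists c.
  apply: filter_from_filter; first by exists 1 => /=.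
  move=> d e d0 e0; have [de|ed] : d <= e \/ e <= d.
    have := @real_leP _ d e (gtr0_real d0) (gtr0_real e0).
    by case=> [|/ltW]; [left|right].
  - exists d => // _ [c /= bc <-]; split; exists c => //=.
    exact: lt_le_trans de.
  - exists e => // _ [c /= bc <-]; split; exists c => //=.
    exact: lt_le_trans ed.
have Fc : cauchy F.
  apply/cauchy_ballP => e e0; have e2 : 0 < e / 2 by rewrite divr_gt0.
  exists (G (e / 2), G (e / 2)) => /=; first by split; exists (e / 2).
  move=> [_ _] /= [[c /= bc <-] [d /= bd <-]].
  rewrite -ball_normE/= (le_lt_trans (contr _ _))// [e]splitr.
  rewrite (_ : iB c - iB d = (b - iB d) - (b - iB c)).
    by rewrite (le_lt_trans (ler_normB _ _))// ltrD.
  by rewrite opprB [RHS]addrC addrA subrK.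
have /cvg_ex[a Fa] : cvg F by exact: cauchy_cvg.
exists a => U [[U1 U2] /= [bU1 aU2] U12].
have [e1 /= e10 be1] : exists2 e : R[i], 0 < e & ball b e `<=` U1.
  by have /nbhs_ballP[e ? ?] := bU1; exists e.
have [e2 /= e20 Ge2] := Fa _ aU2.
have FG : F (U2 `&` G e1) by apply: filterI; [exact: Fa|exists e1].
have [x [U2x [c /= bc cx]]] := filter_ex FG; rewrite -cx in U2x.
exists (iB c, iA (f c)); split; first by exists c.
by apply: U12; split=> //=; apply: be1; rewrite -ball_normE.
Qed.

Lemma completion_extP b : completion_graph (b, completion_ext b).
Proof.
have [a ba] := completion_graph_total b.
exact: (xgetPex point (ex_intro [set a | completion_graph (b, a)] a ba)).
Qed.

Lemma completion_graph_incl c : completion_graph (iB c, iA (f c)).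
Proof. by apply: subset_closure; exists c. Qed.

Lemma completion_ext_incl c : completion_ext (iB c) = iA (f c).
Proof.
apply: (@completion_graph_fun (iB c)); first exact: completion_extP.
exact: completion_graph_incl.
Qed.

Let completion_graph_op (mB : smooth_cstar B -> smooth_cstar B -> smooth_cstar B)
    (mA : smooth_cstar A -> smooth_cstar A -> smooth_cstar A) (m : B -> B -> B) :
  continuous (fun t : smooth_cstar B * smooth_cstar B => mB t.1 t.2) ->
  continuous (fun t : smooth_cstar A * smooth_cstar A => mA t.1 t.2) ->
  (forall c d, iB (m c d) = mB (iB c) (iB d)) ->
  (forall c d, iA (f (m c d)) = mA (iA (f c)) (iA (f d))) ->
  forall b b', completion_ext (mB b b') =
    mA (completion_ext b) (completion_ext b').
Proof.
move=> mBc mAc mBE mAE b b'.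
apply: (@completion_graph_fun (mB b b')); first exact: completion_extP.
move=> U [[U1 U2] /= [bU1 aU2] U12].
have [[V V'] /= [bV bV'] VU] := mBc (b, b') _ bU1.
have [[W W'] /= [aW aW'] WU] :=
  mAc (completion_ext b, completion_ext b') _ aU2.
have [] := completion_extP (b := b) (B := V `*` W); first by exists (V, W).
move=> _ [[c _ <-]] [/= Vc Wc].
have [] := completion_extP (b := b') (B := V' `*` W'); first by exists (V', W').
move=> _ [[d _ <-]] [/= Vd Wd].
exists (iB (m c d), iA (f (m c d))); split; first by exists (m c d).
apply: U12; split=> /=; rewrite ?mBE ?mAE; first exact: (VU (_, _)).
exact: (WU (_, _)).
Qed.

Let lin_continuous (D : smooth_algebra R) (k : R[i]) :
  continuous (fun t : smooth_cstar D * smooth_cstar D => k *: t.1 + t.2).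
Proof.
move=> t; apply: cvgD; last exact: cvg_snd.
by apply: cvgZr; exact: cvg_fst.
Qed.

Lemma completion_ext_star_hom : star_hom completion_ext.
Proof.
have [_ iBM iBS] := smooth_incl_hom B; have [_ iAM iAS] := smooth_incl_hom A.
have [_ fM fS] := smooth_hom_star f.
split=> [k|a b|a].
- apply: (completion_graph_op (m := fun c d => k *: c + d)).
  + exact: lin_continuous.
  + exact: lin_continuous.
  + by move=> c d; rewrite iBl.
  + by move=> c d; rewrite fl iAl.
- apply: (completion_graph_op (m := amul)).
  + exact: cstar_amul_continuous.
  + exact: cstar_amul_continuous.
  + by move=> c d; rewrite iBM.
  + by move=> c d; rewrite fM iAM.
- apply: (completion_graph_op (mB := fun x _ => star x)
    (mA := fun x _ => star x) (m := fun c _ => star c) _ _ _ _ _ a).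
  + by move=> t; apply: (@continuous_comp _ _ _ fst star);
      [exact: cvg_fst|exact: cstar_star_continuous].
  + by move=> t; apply: (@continuous_comp _ _ _ fst star);
      [exact: cvg_fst|exact: cstar_star_continuous].
  + by move=> c d; rewrite iBS.
  + by move=> c d; rewrite fS iAS.
Qed.

End CompletionExtension.

Section Compression.
Context {R : realType} {H : hilbertType R} (P : projection H).

Definition compress_fun (T : bounded_op H H) (v : proj_range P) : proj_range P :=
  ProjRange P (P (T (val v))) (proj_range_fix P (T (val v))).

Lemma compress_subproof (T : bounded_op H H) :
  compress_fun T \in bounded_linear_pred.
Proof.
apply/asboolP; split=> [c x y|].
  by apply: val_inj; rewrite /= !linearP.
have [M M0 PM] := bounded_op_bound P; have [N N0 TN] := bounded_op_bound T.
exists (M * N) => x; rewrite range_normE (le_trans (PM _))//.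
by rewrite rmorphM/= -mulrA ler_wpM2l// ler0c.
Qed.

Definition compress (T : bounded_op H H) :
  bounded_op (proj_range P) (proj_range P) :=
  BoundedOp (compress_fun T) (compress_subproof T).

End Compression.

Definition commutator (R : realType) (V : normedModType R[i])
  (S T : bounded_op V V) : bounded_op V V := S \bo T - T \bo S.

Record ext_pair (R : realType) (A : smooth_algebra R) := ExtPair {
  pair_space : hilbertType R ;
  pair_rep : star_rep (smooth_cstar A) pair_space ;
  pair_proj : projection pair_space }.

Section Extensions.
Context {R : realType} {H : hilbertType R} (K : frechet_ideal H).
Implicit Types A B C : smooth_algebra R.

(* P H is infinite-dimensional because it has to be a Hilbert space on which the
   ideal lives. *)
Definition tau_smooth A (x : ext_pair A) : Prop :=
  let pi := pair_rep x in let P := pair_proj x in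
  [/\ separable_infinite_dimensional (pair_space x),
      separable_infinite_dimensional (proj_range P),
      forall a : A, in_ideal K (commutator (pi (smooth_incl a)) P) &
      [set P \bo pi a \bo P | a in setT] `&` [set T | compact_op T]
        = [set 0]].

Record tau_extension A := TauExtension {
  ext_pair_of :> ext_pair A ;
  ext_smooth : tau_smooth ext_pair_of }.

Definition cp_map A (x : ext_pair A) (a : smooth_cstar A) :
  bounded_op (proj_range (pair_proj x)) (proj_range (pair_proj x)) :=
  compress (pair_proj x) (pair_rep x a).

Definition unitarily_equivalent A (x y : ext_pair A) : Prop :=
  exists U : unitary (proj_range (pair_proj x)) (proj_range (pair_proj y)),
    forall a : A, in_ideal K
      (cp_map x (smooth_incl a)
       - unitary_adj U \bo cp_map y (smooth_incl a) \bo U).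

(* A representation is an extension whose projection is the identity. *)
Definition degenerate A (x : ext_pair A) : Prop :=
  exists y : tau_extension A,
    pair_proj y = op_id :> bounded_op _ _ /\ unitarily_equivalent x y.

Section RepSum.
Context {A : smooth_algebra R} {H1 H2 : hilbertType R}.
Variables (pi1 : star_rep (smooth_cstar A) H1).
Variables (pi2 : star_rep (smooth_cstar A) H2).

Let rep_sum_fun a := op_dsum (pi1 a) (pi2 a).

Let rep_sum_linear : linear rep_sum_fun.
Proof.
move=> c a b; apply: bounded_op_ext => x.
by rewrite /rep_sum_fun /= /dsum_fun !rep_linear.
Qed.

Let rep_sumM a b : rep_sum_fun (amul a b) = rep_sum_fun a \bo rep_sum_fun b.
Proof.
by apply: bounded_op_ext => x; rewrite /rep_sum_fun /= /dsum_fun !repM.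
Qed.

Let rep_sumS a : is_adjoint (rep_sum_fun a) (rep_sum_fun (star a)).
Proof. by move=> x y; congr (_ + _); exact: repS. Qed.

Definition rep_dsum : star_rep (smooth_cstar A) (dsum H1 H2) :=
  StarRep rep_sum_linear rep_sumM rep_sumS.

End RepSum.

Definition pair_dsum A (x y : ext_pair A) : ext_pair A :=
  ExtPair (rep_dsum (pair_rep x) (pair_rep y))
    (proj_dsum (pair_proj x) (pair_proj y)).

(* The default value is never used: the direct sum of two tau-smooth extensions
   is always tau-smooth. *)
Definition ext_dsum A (x y : tau_extension A) : tau_extension A :=
  if pselect (tau_smooth (pair_dsum x y)) is left xy then TauExtension xy else x.

Section PullBack.
Context {B A : smooth_algebra R} (f : smooth_hom B A).

Section RepPull.
Context {H1 : hilbertType R} (pi : star_rep (smooth_cstar A) H1).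

Let rep_pull_fun b := pi (completion_ext f b).

Let rep_pull_linear : linear rep_pull_fun.
Proof.
have [fl _ _] := completion_ext_star_hom f.
by move=> c a b; rewrite /rep_pull_fun fl rep_linear.
Qed.

Let rep_pullM a b : rep_pull_fun (amul a b) = rep_pull_fun a \bo rep_pull_fun b.
Proof.
by have [_ fM _] := completion_ext_star_hom f; rewrite /rep_pull_fun fM repM.
Qed.

Let rep_pullS a : is_adjoint (rep_pull_fun a) (rep_pull_fun (star a)).
Proof.
have [_ _ fS] := completion_ext_star_hom f.
by rewrite /rep_pull_fun fS; exact: repS.
Qed.

Definition rep_pullback : star_rep (smooth_cstar B) H1 :=
  StarRep rep_pull_linear rep_pullM rep_pullS.

End RepPull.

Definition pair_pullback (x : ext_pair A) : ext_pair B :=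
  ExtPair (rep_pullback (pair_rep x)) (pair_proj x).

Lemma pair_pullback_smooth (x : ext_pair A) :
  tau_smooth x -> tau_smooth (pair_pullback x).
Proof.
move=> [sH sP xK xC]; split=> //= [b|].
  by rewrite completion_ext_incl; exact: xK.
apply/seteqP; split=> [T [[b _ bT] cT]|T ->].
  by rewrite -xC; split=> //; exists (completion_ext f b).
have : [set 0] (0 : bounded_op (pair_space x) (pair_space x)) by [].
rewrite -{1}xC => -[_ c0]; split=> //; exists 0 => //.
have [fl _ _] := completion_ext_star_hom f.
have f0 : completion_ext f 0 = 0.
  by rewrite -[X in completion_ext f X](subrr 0) -scaleN1r addrC fl scaleN1r addNr.
have p0 : pair_rep x 0 = 0.
  by rewrite -[X in pair_rep x X](subrr 0) -scaleN1r addrC rep_linear scaleN1r addNr.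
apply: bounded_op_ext => v /=.
by rewrite f0 p0 /= linear0.
Qed.

Definition pullback (x : tau_extension A) : tau_extension B :=
  TauExtension (pair_pullback_smooth (ext_smooth x)).

End PullBack.

(** Two extensions are identified in Ext when they become unitarily equivalent
    after adding degenerate extensions; an element of Ext is the set of all
    extensions identified with a given one. *)

Definition stably_equivalent A (x y : tau_extension A) : Prop :=
  exists d e : tau_extension A,
    [/\ degenerate d, degenerate e &
        unitarily_equivalent (pair_dsum x d) (pair_dsum y e)].

(* The library's type set is too small, for universe reasons, to hold sets of
   extensions. *)
Record Ext A := MkExt {
  ext_set :> tau_extension A -> Prop ;
  ext_setP : exists x, ext_set = stably_equivalent x }.

Definition ext_class A (x : tau_extension A) : Ext A :=
  MkExt (ex_intro (fun z => _ = stably_equivalent z) x erefl).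

Definition ext_repr A (X : Ext A) : tau_extension A := projT1 (cid (ext_setP X)).

Definition ext_add A (X Y : Ext A) : Ext A :=
  ext_class (ext_dsum (ext_repr X) (ext_repr Y)).

Definition ext_pullback B A (f : smooth_hom B A) (X : Ext A) : Ext B :=
  ext_class (pullback f (ext_repr X)).

End Extensions.

Definition abelian_group (G : Type) (add : G -> G -> G) : Prop :=
  [/\ associative add, commutative add &
      exists2 e, left_id e add & forall x, exists y, add y x = e].

(* Main.v *)
(* Any two separable infinite-dimensional Hilbert spaces are unitarily
   equivalent (Gram-Schmidt), so membership in the ideal can be tested by
   factoring through one of its elements, in any space.

   The zero representation is a degenerate extension, and gives the identity of
   Ext.  For the inverse of (pi, P), let E be the projection onto the smallest
   reducing subspace of pi containing the range of P.  Compressed to the range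
   of E, pi contains no nonzero compact operator: if E pi(a) E is compact then
   so is P pi(b* a* a b) P, which hence vanishes, so that pi(a) kills every
   pi(b) P v.  The extension (pi (+) pi, E (+) (E - P)) is therefore tau-smooth,
   the summand E taking care of the compact operators in the corner E - P.  Since
   [pi(a), P] is in the ideal, the compressions of pi to P and E - P add up,
   modulo the ideal, to the compression to E, and the sum with (pi, P) is
   unitarily equivalent to two copies of the representation on the range of E. *)

Require Import Defs.
From mathcomp Require Import all_boot all_order all_algebra.
From mathcomp Require Import complex.
From mathcomp Require Import all_classical all_reals topology normedtype.
From mathcomp Require Import sequences.

Set Implicit Arguments.
Unset Strict Implicit.
Unset Printing Implicit Defensive.

Import Order.TTheory GRing.Theory Num.Theory.
Import numFieldNormedType.Exports.

Local Open Scope classical_set_scope.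
Local Open Scope ring_scope.
Local Open Scope complex_scope.

Local Notation sid := separable_infinite_dimensional.

(** * Inner products: sesquilinearity, Pythagoras, Cauchy-Schwarz, continuity *)

Section InnerProduct.
Context {R : realType} {H : hilbertType R}.
Implicit Types x y z : H.

Lemma ipDr x y z : ip x (y + z) = ip x y + ip x z.
Proof. by rewrite ipC ipDl rmorphD/= -!ipC. Qed.

Lemma ipZr c x y : ip x (c *: y) = Num.conj c * ip x y.
Proof. by rewrite ipC ipZl rmorphM/= -ipC. Qed.

Lemma ip0l y : ip 0 y = 0.
Proof. by rewrite -[0 in LHS](scale0r y) ipZl mul0r. Qed.

Lemma ip0r x : ip x 0 = 0.
Proof. by rewrite ipC ip0l conjC0. Qed.

Lemma ipNl x y : ip (- x) y = - ip x y.
Proof. by rewrite -scaleN1r ipZl mulN1r. Qed.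

Lemma ipNr x y : ip x (- y) = - ip x y.
Proof. by rewrite ipC ipNl rmorphN/= -ipC. Qed.

Lemma ipBl x y z : ip (x - y) z = ip x z - ip y z.
Proof. by rewrite ipDl ipNl. Qed.

Lemma ipBr x y z : ip x (y - z) = ip x y - ip x z.
Proof. by rewrite ipDr ipNr. Qed.

Lemma ip_suml I (r : seq I) (P : pred I) (F : I -> H) y :
  ip (\sum_(i <- r | P i) F i) y = \sum_(i <- r | P i) ip (F i) y.
Proof.
by apply: (big_morph (fun x => ip x y)) => [u v|]; rewrite ?ipDl ?ip0l.
Qed.

Lemma ip_sumr I (r : seq I) (P : pred I) (F : I -> H) x :
  ip x (\sum_(i <- r | P i) F i) = \sum_(i <- r | P i) ip x (F i).
Proof.
by apply: (big_morph (fun y => ip x y)) => [u v|]; rewrite ?ipDr ?ip0r.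
Qed.

Lemma ip_eq0 x : (ip x x == 0) = (x == 0).
Proof. by rewrite ip_norm expf_eq0/= normr_eq0. Qed.

Lemma ip_eq0P x : (forall y, ip x y = 0) -> x = 0.
Proof. by move=> /(_ x) /eqP; rewrite ip_eq0 => /eqP. Qed.

Lemma ip_ext x y : (forall z, ip x z = ip y z) -> x = y.
Proof.
move=> xy; apply/eqP; rewrite -subr_eq0; apply/eqP/ip_eq0P => z.
by rewrite ipBl xy subrr.
Qed.

Lemma pythagoras x y : ip x y = 0 -> `|x + y| ^+ 2 = `|x| ^+ 2 + `|y| ^+ 2.
Proof.
move=> xy; rewrite -!ip_norm ipDl !ipDr xy [ip y x]ipC xy conjC0.
by rewrite addr0 add0r.
Qed.

(** Pythagoras for [x] and its orthogonal projection [c *: y] on the line of [y] gives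
    [|c *: y| <= |x|]. *)
Lemma cauchy_schwarz x y : `|ip x y| <= `|x| * `|y|.
Proof.
have [->|y0] := eqVneq y 0; first by rewrite ip0r !normr0 mulr0.
have yp : 0 < `|y| by rewrite normr_gt0.
pose c := ip x y / ip y y.
have yy : ip y y != 0 by rewrite ip_eq0.
have o : ip (x - c *: y) (c *: y) = 0.
  by rewrite ipZr ipBl ipZl /c divfK// subrr mulr0.
have := pythagoras o; rewrite subrK => e.
have le : `|c *: y| <= `|x|.
  by rewrite -(@ler_pXn2r _ 2)// ?nnegrE// e lerDr exprn_ge0.
rewrite -(ler_pM2r yp) in le; apply: le_trans le.
rewrite normrZ -mulrA -expr2 -ip_norm /c normrM normfV.
rewrite [X in _ / X]ger0_norm ?divfK//.
by rewrite ip_norm exprn_ge0.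
Qed.

End InnerProduct.

Lemma lipschitz_cvg (R : realType) (V W : normedModType R[i]) (f : V -> W)
  (M : R[i]) (T : Type) (F : set_system T) (u : T -> V) (l : V) : Filter F ->
  (forall x y, `|f x - f y| <= M * `|x - y|) ->
  u @ F --> l -> f (u t) @[t --> F] --> f l.
Proof.
move=> FF fM /cvgrPdist_lt ul; apply/cvgrPdist_lt => e e0.
have M1 : 0 < `|M| + 1 by rewrite ltr_wpDl.
near=> t; apply: le_lt_trans (fM _ _) _.
have ld : `|l - u t| < e / (`|M| + 1).
  by near: t; apply: ul; rewrite divr_gt0.
(* [M] is a complex number, but the Lipschitz bound forces it to be nonnegative as soon as [l] and
   [u t] differ. *)
have MR : M * `|l - u t| <= `|M| * `|l - u t|.
  have := fM l (u t); have [->|lu] := eqVneq l (u t).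
    by rewrite !subrr !normr0 !mulr0.
  have lup : 0 < `|l - u t| by rewrite normr_gt0 subr_eq0.
  move=> h; rewrite ler_pM2r// ger0_norm//.
  by rewrite -(pmulr_lge0 _ lup) (le_trans _ h).
apply: le_lt_trans MR _; apply: (@le_lt_trans _ _ ((`|M| + 1) * `|l - u t|)).
  by rewrite ler_wpM2r// lerDl.
by rewrite -ltr_pdivlMl// mulrC.
Unshelve. all: by end_near. Qed.

Section IpContinuity.
Context {R : realType} {H : hilbertType R}.

Lemma ip_cvgl T (F : set_system T) (u : T -> H) l y : Filter F ->
  u @ F --> l -> (ip (u t) y : R[i]^o) @[t --> F] --> (ip l y : R[i]^o).
Proof.
move=> FF; apply: (@lipschitz_cvg _ _ R[i]^o (ip^~ y) `|y|) => x z.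
by rewrite -ipBl mulrC; exact: cauchy_schwarz.
Qed.

Lemma ip_cvgr T (F : set_system T) (u : T -> H) l x : Filter F ->
  u @ F --> l -> (ip x (u t) : R[i]^o) @[t --> F] --> (ip x l : R[i]^o).
Proof.
move=> FF; apply: (@lipschitz_cvg _ _ R[i]^o (ip x) `|x|) => y z.
by rewrite -ipBr; exact: cauchy_schwarz.
Qed.

End IpContinuity.

(* The generic linearity lemmas leave the canonical structure of the operator
   visible, which blocks later rewriting; these versions do not. *)
Section BoundedOpLinear.
Context {R : realType} {V W : normedModType R[i]} (T : bounded_op V W).

Lemma bopD x y : T (x + y) = T x + T y. Proof. exact: linearD. Qed.
Lemma bopB x y : T (x - y) = T x - T y. Proof. exact: linearB. Qed.
Lemma bopN x : T (- x) = - T x. Proof. exact: linearN. Qed.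
Lemma bopZ c x : T (c *: x) = c *: T x. Proof. exact: linearZ. Qed.
Lemma bop0 : T 0 = 0. Proof. exact: linear0. Qed.

Lemma bop_sum I (r : seq I) (P : pred I) (F : I -> V) :
  T (\sum_(i <- r | P i) F i) = \sum_(i <- r | P i) T (F i).
Proof. exact: linear_sum. Qed.

End BoundedOpLinear.

(** * Orthonormal systems and convergence of Fourier series *)

(** Meant for [a] the partial sums of squared Fourier coefficients: [u] inherits the Cauchy property
    of the convergent real sequence [a]. *)
Lemma sqr_cauchy_cvg (R : realType) (V : completeNormedModType R[i])
  (u : nat -> V) (a : nat -> R) : cvgn a ->
  (forall m n, (m <= n)%N -> `|u n - u m| ^+ 2 <= (a n - a m)%:C) -> cvgn u.
Proof.
move=> /cvg_ex[l al] ua; apply: cauchy_cvg; apply: cauchy_exP => e e0.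
have er : e = (complex.Re e)%:C by rewrite RRe_real// gtr0_real.
have r0 : 0 < complex.Re e by rewrite -(@ltcR R) -er.
have r2 : 0 < complex.Re e ^+ 2 / 2 by rewrite divr_gt0// exprn_gt0.
move/cvgrPdist_lt : al => /(_ _ r2) [N _ aN].
exists (u N); exists N => // n /= Nn; rewrite -ball_normE/= distrC.
rewrite -(@ltr_pXn2r _ 2)// ?nnegrE ?(ltW e0)//.
apply: le_lt_trans (ua _ _ Nn) _; rewrite er -rmorphXn/= ltcR.
rewrite (_ : a n - a N = (l - a N) - (l - a n)); last first.
  by rewrite opprB [RHS]addrC addrA subrK.
rewrite (le_lt_trans (ler_norm _))// (le_lt_trans (ler_normB _ _))//.
by rewrite [ltRHS]splitr ltrD//; apply: aN => /=.
Qed.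

(* A vector of an orthonormal system is allowed to vanish, so that Gram-Schmidt
   can be run on a sequence that is not linearly independent. *)
Definition orthosys (R : realType) (H : hilbertType R) (e : nat -> H) : Prop :=
  forall i j, ip (e i) (e j) = ((i == j) && (e i != 0))%:R.

Definition fourier_sum (R : realType) (H1 H2 : hilbertType R) (e : nat -> H1)
  (f : nat -> H2) (x : H1) (n : nat) : H2 :=
  \sum_(0 <= k < n) ip x (e k) *: f k.

Section Fourier.
Context {R : realType}.
Implicit Types H : hilbertType R.

(** Induction on [n], splitting off the last term by Pythagoras; the factor [(f k != 0)%:R] removes
    the terms at vanishing vectors. *)
Lemma orthosys_norm_sum H (f : nat -> H) (c : nat -> R[i]) m n :
  orthosys f ->
  `|\sum_(m <= k < n) c k *: f k| ^+ 2
    = \sum_(m <= k < n) `|c k| ^+ 2 * (f k != 0)%:R.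
Proof.
move=> of_; elim: n => [|n IH]; first by rewrite !big_geq// normr0 expr0n.
have [mn|nm] := leqP m n; last by rewrite !big_geq// normr0 expr0n.
rewrite !big_nat_recr//= pythagoras ?IH; last first.
  rewrite ipZr ip_suml big_nat big1 ?mulr0// => k /andP[_ kn].
  by rewrite ipZl of_ (ltn_eqF kn)/= mulr0.
by congr (_ + _); rewrite normrZ exprMn -[`|f n| ^+ 2]ip_norm of_ eqxx.
Qed.

Lemma ip_orthosys_neq0 H (e : nat -> H) x k : 
  ip x (e k) * (e k != 0)%:R = ip x (e k).
Proof. by have [->|] := eqVneq (e k) 0; rewrite ?ip0r ?mul0r ?mulr1. Qed.

Lemma ip_fourier_sum H1 H2 (e : nat -> H1) (f : nat -> H2) x n k :
  orthosys f -> (k < n)%N ->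
  ip (fourier_sum e f x n) (f k) = ip x (e k) * (f k != 0)%:R.
Proof.
move=> of_ kn; rewrite ip_suml big_mkord (bigD1 (Ordinal kn))//= big1 => [|i ik].
  by rewrite ipZl of_ eqxx/= addr0.
rewrite ipZl of_ [_ == k](_ : _ = false) ?mulr0//.
by apply: contraNF ik => /eqP ik; apply/eqP/val_inj.
Qed.

(** The Fourier sum [S] is the orthogonal projection of [x]: [x - S] is orthogonal to [S], and
    Pythagoras applies. *)
Lemma bessel H (e : nat -> H) x n : orthosys e ->
  \sum_(0 <= k < n) `|ip x (e k)| ^+ 2 <= `|x| ^+ 2.
Proof.
move=> oe; set S := fourier_sum e e x n.
have SE : `|S| ^+ 2 = \sum_(0 <= k < n) `|ip x (e k)| ^+ 2.
  rewrite orthosys_norm_sum//; apply: eq_bigr => k _.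
  have [->|] := eqVneq (e k) 0; rewrite ?mulr1// ip0r normr0 expr0n mul0r//.
have o : ip (x - S) S = 0.
  rewrite {2}/S ip_sumr big_nat big1// => k /andP[_ kn].
  by rewrite ipZr ipBl ip_fourier_sum// ip_orthosys_neq0 subrr mulr0.
by rewrite -SE -[x in leRHS](subrK S) (pythagoras o) lerDr exprn_ge0.
Qed.

Lemma fourier_sum_bound H1 H2 (e : nat -> H1) (f : nat -> H2) x n :
  orthosys e -> orthosys f -> `|fourier_sum e f x n| <= `|x|.
Proof.
move=> oe of_; rewrite -(@ler_pXn2r _ 2)// ?nnegrE//.
apply: le_trans (bessel x n oe); rewrite orthosys_norm_sum//.
by apply: ler_sum => k _; case: (f k != 0); rewrite ?mulr1// mulr0 exprn_ge0.
Qed.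

(** The partial sums [a] of the squared coefficients are bounded by Bessel, hence converge, and they
    dominate the squared increments of the Fourier sums. Real parts are taken so that [a] is a
    monotone sequence in [R]. *)
Lemma fourier_sum_cvg H1 H2 (e : nat -> H1) (f : nat -> H2) x :
  orthosys e -> orthosys f -> cvgn (fourier_sum e f x).
Proof.
move=> oe of_.
pose a n := \sum_(0 <= k < n) complex.Re `|ip x (e k)| ^+ 2.
have aE m n : (\sum_(m <= k < n) complex.Re `|ip x (e k)| ^+ 2)%:C
    = \sum_(m <= k < n) `|ip x (e k)| ^+ 2.
  rewrite rmorph_sum/=; apply: eq_bigr => k _.
  by rewrite rmorphXn; congr (_ ^+ 2); rewrite RRe_real// ger0_real.
have aD m n : (m <= n)%N ->
    a n - a m = \sum_(m <= k < n) complex.Re `|ip x (e k)| ^+ 2.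
  by move=> mn; rewrite /a (big_cat_nat _ mn)// addrAC subrr add0r.
apply: (@sqr_cauchy_cvg _ H2 _ a) => [|m n mn].
  apply: nondecreasing_is_cvgn => [m n mn|].
    by rewrite -subr_ge0 aD// sumr_ge0// => k _; exact: sqr_ge0.
  exists (complex.Re `|x| ^+ 2) => _ [n _ <-].
  by rewrite -(@lecR R) aE rmorphXn/= Cnorm_Re bessel.
have -> : fourier_sum e f x n - fourier_sum e f x m
    = \sum_(m <= k < n) ip x (e k) *: f k.
  by rewrite /fourier_sum (big_cat_nat _ mn)// addrAC subrr add0r.
rewrite aD// aE orthosys_norm_sum//.
by apply: ler_sum => k _; case: (f k != 0); rewrite ?mulr1// mulr0 exprn_ge0.
Qed.

End Fourier.

Lemma normed_cvg_unique (R : realType) (V : normedModType R[i]) (F : set_system V) (x y : V) :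
  ProperFilter F -> F --> x -> F --> y -> x = y.
Proof. by move=> FF Fx Fy; exact: (cvg_unique (@norm_hausdorff _ V) Fx Fy). Qed.

(** * Operators carrying one orthonormal system to another *)

Section FourierOperator.
Context {R : realType}.
Implicit Types H : hilbertType R.

Section Operator.
Context {H1 H2 : hilbertType R} {e : nat -> H1} {f : nat -> H2}.
Hypotheses (oe : orthosys e) (of_ : orthosys f).

(** When [e] and [f] vanish at the same indices, this is the partial isometry that sends [e k] to
    [f k] and kills the orthogonal complement of [e]. *)
Definition fourier_fun (x : H1) : H2 := limn (fourier_sum e f x).

Lemma fourier_funP x : fourier_sum e f x @ \oo --> fourier_fun x.
Proof. exact: fourier_sum_cvg. Qed.
Arguments fourier_funP : clear implicits.

Lemma fourier_fun_subproof : fourier_fun \in bounded_linear_pred.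
Proof.
apply/asboolP; split=> [c x y|].
  have : fourier_sum e f (c *: x + y) @ \oo --> c *: fourier_fun x + fourier_fun y.
    rewrite (_ : fourier_sum _ _ _
        = (fun n => c *: fourier_sum e f x n + fourier_sum e f y n)).
      apply: cvgD; last exact: fourier_funP.
      by apply: cvgZl_tmp; exact: fourier_funP.
    apply/funext => n; rewrite /fourier_sum scaler_sumr -big_split/=.
    by apply: eq_bigr => k _; rewrite ipDl ipZl scalerDl scalerA.
  by move=> h; apply: (normed_cvg_unique _ (fourier_funP _) h).
exists 1 => x; rewrite mul1r.
have /cvgrPdist_lt xl := fourier_funP x.
apply/ler_addgt0Pr => d d0; have [N _ /(_ N (leqnn N)) xN] := xl _ d0.
rewrite -[fourier_fun x](subrK (fourier_sum e f x N)) addrC.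
rewrite (le_trans (ler_normD _ _))// lerD//; last exact: ltW.
exact: fourier_sum_bound.
Qed.

Definition fourier_op : bounded_op H1 H2 := BoundedOp fourier_fun fourier_fun_subproof.

Lemma fourier_op_basis k : (e k == 0) = (f k == 0) -> fourier_op (e k) = f k.
Proof.
move=> ef; apply: (normed_cvg_unique _ (fourier_funP _)).
apply: cvg_near_cst; exists k.+1 => // n /= kn.
rewrite /fourier_sum big_mkord (bigD1 (Ordinal kn))//= big1 => [|i ik].
  by rewrite oe eqxx/= ef addr0; have [->|_] := eqVneq (f k) 0;
    rewrite ?scale0r ?scale1r.
rewrite oe [k == _](_ : _ = false) ?scale0r//.
by apply: contraNF ik => /eqP ik; apply/eqP/val_inj.
Qed.

End Operator.
Arguments fourier_funP {H1 H2 e f} oe of_ x.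

(** The identity holds term by term for the partial sums and passes to the limit by continuity of
    the inner product. *)
Lemma fourier_op_adj H1 H2 (e : nat -> H1) (f : nat -> H2)
  (oe : orthosys e) (of_ : orthosys f) :
  is_adjoint (fourier_op oe of_) (fourier_op of_ oe).
Proof.
move=> x y.
have h1 : (ip (fourier_sum e f x n) y : R[i]^o) @[n --> \oo]
    --> (ip (fourier_op oe of_ x) y : R[i]^o).
  by apply: ip_cvgl; exact: fourier_funP.
have h2 : (ip x (fourier_sum f e y n) : R[i]^o) @[n --> \oo]
    --> (ip x (fourier_op of_ oe y) : R[i]^o).
  by apply: ip_cvgr; exact: fourier_funP.
apply: (@normed_cvg_unique _ R[i]^o _ _ _ _ h1).
rewrite (_ : (fun n => _) = (fun n => (ip x (fourier_sum f e y n) : R[i]^o))).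
  exact: h2.
apply/funext => n; rewrite ip_suml ip_sumr; apply: eq_bigr => k _.
by rewrite ipZl ipZr mulrC -ipC.
Qed.

(** By continuity the outer operator may be applied to the partial sums, where it replaces each
    [f k] by [g k]. *)
Lemma fourier_op_comp H1 H2 H3 (e : nat -> H1) (f : nat -> H2) (g : nat -> H3)
  (oe : orthosys e) (of_ : orthosys f) (og : orthosys g) :
  (forall k, (e k == 0) = (f k == 0)) -> (forall k, (f k == 0) = (g k == 0)) ->
  fourier_op of_ og \bo fourier_op oe of_ = fourier_op oe og.
Proof.
move=> ef fg; apply: bounded_op_ext => x /=.
have h : fourier_op of_ og (fourier_sum e f x n) @[n --> \oo]
    --> fourier_op of_ og (fourier_op oe of_ x).
  by apply: continuous_cvg; [exact: op_continuous|exact: fourier_funP].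
apply: (normed_cvg_unique _ h); rewrite (_ : (fun n => _) = fourier_sum e g x).
  exact: fourier_funP.
apply/funext => n; rewrite bop_sum; apply: eq_bigr => k _.
by rewrite bopZ fourier_op_basis.
Qed.

Lemma fourier_op_closed H1 H2 (e : nat -> H1) (f : nat -> H2)
  (oe : orthosys e) (of_ : orthosys f) (N : set H2) x :
  closed N -> N 0 -> (forall c x y, N x -> N y -> N (c *: x + y)) ->
  (forall k, N (f k)) -> N (fourier_op oe of_ x).
Proof.
move=> cN N0 NL Nf; apply: (closed_cvg _ cN _ _ (fourier_funP oe of_ x)).
apply: nearW => n; rewrite /fourier_sum.
by apply: (big_ind N) => // [u v Nu Nv|k _];
  [rewrite -[u]scale1r; exact: NL|rewrite -[_ *: _]addr0; exact: NL].
Qed.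

End FourierOperator.

(** * Gram-Schmidt, projections onto closed subspaces, unitaries between spaces *)

(** For each point [d m] of the countable dense set and each radius [1/(k+1)], one point of [N] in
    that ball is picked if there is one. The default [0] keeps the whole sequence in [N]. *)
Lemma dense_seq_subset (R : realType) (H : hilbertType R) (N : set H) :
  separable_space H -> N 0 ->
  exists2 g : nat -> H, forall n, N (g n) &
    forall x (r : R), N x -> 0 < r -> exists n, `|x - g n| < r%:C.
Proof.
move=> [S /countable_injP[f fI] dS] N0.
pose d n := xget 0 [set x | S x /\ f x = n].
have dK x : S x -> d (f x) = x.
  move=> Sx; have [Sd fd] : S (d (f x)) /\ f (d (f x)) = f x.
    exact: (@xgetPex _ 0 [set z | S z /\ f z = f x] (ex_intro _ x (conj Sx erefl))).
  by apply: fI => //; rewrite inE.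
pose G m k := [set y | N y /\ `|d m - y| < (k.+1%:R^-1)%:C].
pose g n := if @unpickle (nat * nat)%type n is Some (m, k) then xget 0 (G m k) else 0.
exists g => [n|x r Nx r0].
  rewrite /g; case: unpickle => // -[m k].
  by case: xgetP => // y -> [].
have r2 : 0 <= (r / 2)^-1 by rewrite invr_ge0 divr_ge0// ltW.
pose k := Num.bound ((r / 2)^-1).
have kr : k.+1%:R^-1 <= r / 2.
  rewrite -[leRHS]invrK lef_pV2 ?posrE ?invr_gt0 ?divr_gt0 ?ltr0Sn//.
  by rewrite (le_trans (ltW (archi_boundP r2)))// ler_nat.
have k0 : 0 < (k.+1%:R^-1 : R)%:C by rewrite ltcR invr_gt0 ltr0Sn.
have [s [xs Ss]] : (ball x (k.+1%:R^-1)%:C `&` S) !=set0.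
  by apply: dS; [exists x; exact: ballxx|exact: ball_open].
move: xs; rewrite -ball_normE/= => xs.
exists (pickle (f s, k)); rewrite /g pickleK.
have [_ sy] : G (f s) k (xget 0 (G (f s) k)).
  by apply: xgetPex; exists x; split=> //; rewrite dK// distrC.
rewrite dK// in sy; set y := xget _ _ in sy *.
rewrite (_ : x - y = (x - s) + (s - y)); last by rewrite addrA subrK.
rewrite (le_lt_trans (ler_normD _ _))// [r]splitr rmorphD.
by rewrite (lt_le_trans (ltrD xs sy))// lerD// lecR.
Qed.

Section GramSchmidt.
Context {R : realType} {H : hilbertType R}.

(** Sends [0] to [0], so a linearly dependent term in Gram-Schmidt produces a vanishing vector. *)
Definition unit_vector (x : H) : H := `|x|^-1 *: x.

Lemma unit_vectorK x : `|x| *: unit_vector x = x.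
Proof.
have [->|x0] := eqVneq x 0; first by rewrite /unit_vector !scaler0.
by rewrite scalerA divff ?normr_eq0// scale1r.
Qed.

Lemma unit_vector_eq0 x : (unit_vector x == 0) = (x == 0).
Proof. by rewrite scaler_eq0 invr_eq0 normr_eq0 orbb. Qed.

Lemma ip_unit_vector x : ip (unit_vector x) (unit_vector x) = (x != 0)%:R.
Proof.
have [->|x0] := eqVneq x 0; first by rewrite /unit_vector scaler0 ip0l.
rewrite ip_norm normrZ normfV normr_id mulVf ?normr_eq0//.
by rewrite expr1n.
Qed.

Variable g : nat -> H.

(** Each new vector depends on all earlier ones, so the recursion builds the list of the first [n]
    vectors. *)
Fixpoint gram_schmidt_seq (n : nat) : seq H :=
  if n is m.+1 then
    let s := gram_schmidt_seq m in
    rcons s (unit_vector (g m - \sum_(v <- s) ip (g m) v *: v))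
  else [::].

Definition gram_schmidt (n : nat) : H := last 0 (gram_schmidt_seq n.+1).

Lemma gram_schmidt_seqE n : gram_schmidt_seq n = mkseq gram_schmidt n.
Proof.
elim: n => // n IH; rewrite mkseqS -IH.
by rewrite /gram_schmidt/= last_rcons.
Qed.

Lemma gram_schmidtE n : gram_schmidt n = unit_vector
  (g n - fourier_sum gram_schmidt gram_schmidt (g n) n).
Proof.
rewrite {1}/gram_schmidt/= last_rcons gram_schmidt_seqE big_map.
by rewrite /fourier_sum /index_iota subn0.
Qed.

Lemma gram_schmidt_ortho : orthosys gram_schmidt.
Proof.
set e := gram_schmidt.
have o n : forall i, (i < n)%N -> ip (e n) (e i) = 0.
  elim/ltn_ind: n => n IH i i_n.
  (* Truncated at [n], the sequence is a full [orthosys] by the induction hypothesis, as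
     [ip_fourier_sum] requires. *)
  pose f k := if (k < n)%N then e k else 0.
  have of_ : orthosys f.
    have fe k : ip (f k) (f k) = (f k != 0)%:R.
      rewrite /f; case: ifP => _; last by rewrite ip0l eqxx.
      by rewrite /e gram_schmidtE ip_unit_vector unit_vector_eq0.
    move=> j k; have [->|jk] := eqVneq j k; first exact: fe.
    rewrite /f; case: (ltnP j n) => jn; last by rewrite ip0l.
    case: (ltnP k n) => kn; last by rewrite ip0r.
    case: (ltngtP j k) => [h|h|h]; last by rewrite h eqxx in jk.
      by rewrite ipC IH// conjC0.
    exact: IH.
  have fi : e i = f i by rewrite /f i_n.
  rewrite {1}/e gram_schmidtE -/e ipZl ipBl.
  rewrite (_ : fourier_sum e e (g n) n = fourier_sum f f (g n) n); last first.
    by apply: eq_big_nat => k /andP[_ kn]; rewrite /f kn.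
  by rewrite fi ip_fourier_sum// ip_orthosys_neq0 subrr mulr0.
move=> i j; case: (ltngtP i j) => [h|h|->] /=.
- by rewrite ipC o// conjC0.
- by rewrite o.
- by rewrite /e gram_schmidtE ip_unit_vector unit_vector_eq0.
Qed.

Lemma gram_schmidt_mem (N : set H) : N 0 ->
  (forall c x y, N x -> N y -> N (c *: x + y)) -> (forall n, N (g n)) ->
  forall n, N (gram_schmidt n).
Proof.
move=> N0 NL Ng; have NZ c x : N x -> N (c *: x).
  by move=> Nx; rewrite -[_ *: _]addr0; exact: NL.
elim/ltn_ind => n IH; rewrite gram_schmidtE; apply: (NZ).
rewrite -scaleN1r addrC; apply: (NL) => //.
rewrite /fourier_sum big_nat; apply: (big_ind N) => // [x y Nx Ny|k /andP[_ kn]].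
  by rewrite -[x]scale1r; exact: NL.
by apply: NZ; exact: IH.
Qed.

End GramSchmidt.

Section Basis.
Context {R : realType} {H : hilbertType R}.

(** Gram-Schmidt is run on a sequence [g] dense in [N]. Each [g n] is a combination of the first
    [n.+1] vectors, hence fixed by [fourier_op oe oe]; by boundedness so is every [x] in [N]. *)
Lemma orthosys_total (N : set H) : separable_space H -> N 0 ->
  (forall c x y, N x -> N y -> N (c *: x + y)) ->
  exists (e : nat -> H) (oe : orthosys e), (forall k, N (e k)) /\
    forall x, N x -> fourier_op oe oe x = x.
Proof.
move=> sH N0 NL; have [g Ng gd] := dense_seq_subset sH N0.
have oe := gram_schmidt_ortho g.
exists (gram_schmidt g), oe; split; first exact: gram_schmidt_mem.
set T := fourier_op oe oe.
have Tg n : T (g n) = g n.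
  have -> : g n = `|g n - fourier_sum (gram_schmidt g) (gram_schmidt g) (g n) n|
     *: gram_schmidt g n + fourier_sum (gram_schmidt g) (gram_schmidt g) (g n) n.
    set w := g n - _; have -> : gram_schmidt g n = unit_vector w by exact: gram_schmidtE.
    by rewrite unit_vectorK subrK.
  rewrite bopD bopZ; congr (_ *: _ + _).
    exact: fourier_op_basis.
  rewrite /fourier_sum bop_sum; apply: eq_bigr => k _.
  by rewrite bopZ fourier_op_basis.
move=> x Nx; have [M M0 TM] := bounded_op_bound T.
apply/eqP; rewrite -subr_eq0 -normr_le0; apply/ler_addgt0Pr => d d0.
have dr : d = (complex.Re d)%:C by rewrite RRe_real// gtr0_real.
have r0 : 0 < complex.Re d by rewrite -(@ltcR R) -dr.
have M1 : 0 < M + 1 by rewrite ltr_wpDl.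
have [n xn] := gd x (complex.Re d / (M + 1)) Nx (divr_gt0 r0 M1).
rewrite (_ : T x - x = T (x - g n) - (x - g n)); last first.
  by rewrite bopB Tg opprB addrA subrK.
rewrite add0r (le_trans (ler_normB _ _))//.
apply: (@le_trans _ _ ((M + 1)%:C * `|x - g n|)).
  by rewrite rmorphD mulrDl mul1r lerD.
rewrite dr -ler_pdivlMl ?ltcR// ltW// (lt_le_trans xn)//.
by rewrite rmorphM/= mulrC -fmorphV.
Qed.

(** For a system in [N] that is total there, the Fourier operator fixes [N], and its values stay in
    [N] because [N] is closed. *)
Theorem closed_subspace_projection (N : set H) : separable_space H ->
  closed N -> N 0 -> (forall c x y, N x -> N y -> N (c *: x + y)) ->
  exists F : projection H, forall x, F x = x <-> N x.
Proof.
move=> sH cN N0 NL; have [e [oe [eN eT]]] := orthosys_total sH N0 NL.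
exists (Projection (fourier_op_comp oe oe oe (fun=> erefl) (fun=> erefl))
  (fourier_op_adj oe oe)) => x; split=> [<-|]; last exact: eT.
exact: fourier_op_closed.
Qed.

(** The vanishing vectors of a total system are discarded; infinite dimension leaves infinitely many
    others, which are enumerated again by the natural numbers. *)
Lemma orthonormal_basis : separable_infinite_dimensional H ->
  exists (e : nat -> H) (oe : orthosys e), (forall k, e k != 0) /\ fourier_op oe oe = op_id.
Proof.
move=> [sH iH].
have [e [oe [_ eT]]] := @orthosys_total setT sH I (fun _ _ _ _ _ => I).
have inf : infinite_set [set k | e k != 0].
  (* Otherwise all [e k] with [k >= M] vanish, and every vector is a combination of the first
     [M]. *)
  move=> /finite_seqP[s es].
  have [M sM] : exists M, forall k, (M <= k)%N -> e k = 0.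
    exists (\max_(i <- s) i).+1 => k Mk; apply/eqP/negPn/negP => ek.
    have : k \in s by have : [set` s] k by rewrite -es.
    move=> ks; move: Mk; rewrite ltnNge.
    by rewrite (@bigop.leq_bigmax_seq _ s xpredT id).
  have [x xM] := iH M (fun k => e k); apply: (xM (fun k => ip x (e k))).
  have h : fourier_sum e e x @ \oo --> x.
    by rewrite -[X in _ --> X](eT x I); exact: fourier_funP.
  apply: (normed_cvg_unique _ h).
  apply: cvg_near_cst; exists M => // n /= Mn.
  rewrite /fourier_sum (big_cat_nat (leq0n M) Mn) big_mkord/=.
  rewrite [X in _ + X]big_nat [X in _ + X]big1 ?addr0// => k /andP[Mk _].
  by rewrite sM// scaler0.
have /card_set_bijP[i [iF iI iS]] := card_esym (eq_card_nat (countableP _) inf).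
have oi : orthosys (e \o i).
  move=> j k; rewrite /= oe; congr ((_ && _)%:R).
  by apply/eqP/eqP => [|->//]; apply: iI; rewrite inE.
exists (e \o i), oi; split=> [k|]; first exact: (iF k I).
set T := fourier_op oi oi.
have Te k : T (e k) = e k.
  have [->|ek] := eqVneq (e k) 0; first by rewrite linear0.
  by have [j _ <-] := iS k ek; exact: (fourier_op_basis oi oi).
apply: bounded_op_ext => x.
have h : T (fourier_sum e e x n) @[n --> \oo] --> T (fourier_op oe oe x).
  by apply: continuous_cvg; [exact: op_continuous|exact: fourier_funP].
rewrite eT// in h; apply: (normed_cvg_unique _ h).
rewrite (_ : (fun n => _) = fourier_sum e e x).
  by rewrite -[X in _ --> X](eT x I); exact: fourier_funP.
apply/funext => n; rewrite bop_sum; apply: eq_bigr => k _.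
by rewrite bopZ Te.
Qed.

End Basis.

Theorem unitary_exists (R : realType) (H1 H2 : hilbertType R) :
  separable_infinite_dimensional H1 -> separable_infinite_dimensional H2 ->
  exists U : unitary H1 H2, True.
Proof.
move=> /orthonormal_basis[e [oe [e0 eT]]] /orthonormal_basis[f [of_ [f0 fT]]].
have ef k : (e k == 0) = (f k == 0) by rewrite (negbTE (e0 k)) (negbTE (f0 k)).
unshelve eexists; last by [].
apply: (@Unitary _ _ _ (fourier_op oe of_) (fourier_op of_ oe)).
- exact: fourier_op_adj.
- by rewrite fourier_op_comp.
- by rewrite fourier_op_comp.
Qed.

(** * Coordinate maps of direct sums and inclusions of ranges *)

Section BasicOperators.
Context {R : realType}.

Lemma bounded_linear_mem (V W : normedModType R[i]) (f : V -> W) (M : R) :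
  linear f -> (forall x, `|f x| <= M%:C * `|x|) -> f \in bounded_linear_pred.
Proof. by move=> fl fM; apply/asboolP; split=> //; exists M. Qed.

Context {H1 H2 : hilbertType R}.

Definition dsum_inl (x : H1) : dsum H1 H2 := (x, 0).
Definition dsum_inr (x : H2) : dsum H1 H2 := (0, x).

Lemma dsum_eq (x y : dsum H1 H2) : x.1 = y.1 -> x.2 = y.2 -> x = y.
Proof. by case: x y => [a b] [c d] /= -> ->. Qed.

Lemma dsum_inl_subproof : dsum_inl \in bounded_linear_pred.
Proof.
apply: (@bounded_linear_mem _ _ _ 1) => [c x y|x].
  by apply: dsum_eq => //=; rewrite scaler0 addr0.
by rewrite mul1r (le_trans (dsum_norm_le _))//= normr0 addr0.
Qed.

Lemma dsum_inr_subproof : dsum_inr \in bounded_linear_pred.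
Proof.
apply: (@bounded_linear_mem _ _ _ 1) => [c x y|x].
  by apply: dsum_eq => //=; rewrite scaler0 addr0.
by rewrite mul1r (le_trans (dsum_norm_le _))//= normr0 add0r.
Qed.

Lemma dsum_fst_subproof : (fst : dsum H1 H2 -> H1) \in bounded_linear_pred.
Proof.
apply: (@bounded_linear_mem _ _ _ 1) => [c x y|x] //.
by rewrite mul1r dsum_norm_fst.
Qed.

Lemma dsum_snd_subproof : (snd : dsum H1 H2 -> H2) \in bounded_linear_pred.
Proof.
apply: (@bounded_linear_mem _ _ _ 1) => [c x y|x] //.
by rewrite mul1r dsum_norm_snd.
Qed.

Definition op_inl := BoundedOp dsum_inl dsum_inl_subproof.
Definition op_inr := BoundedOp dsum_inr dsum_inr_subproof.
Definition op_fst : bounded_op (dsum H1 H2) H1 :=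
  @BoundedOp R (dsum H1 H2) H1 _ dsum_fst_subproof.
Definition op_snd : bounded_op (dsum H1 H2) H2 :=
  @BoundedOp R (dsum H1 H2) H2 _ dsum_snd_subproof.

(** Reduces direct sums to compositions and a sum, under which the ideal is stable. *)
Lemma op_dsumE (S : bounded_op H1 H1) (T : bounded_op H2 H2) :
  op_dsum S T = (op_inl \bo S \bo op_fst) + (op_inr \bo T \bo op_snd).
Proof.
apply: bounded_op_ext => x; apply: dsum_eq => /=.
  by rewrite -[LHS]addr0.
by rewrite -[LHS]add0r.
Qed.

End BasicOperators.

Section RangeOperators.
Context {R : realType} {H : hilbertType R} (P : projection H).

Definition range_corestr (x : H) : proj_range P :=
  ProjRange P (P x) (proj_range_fix P x).

Lemma range_incl_subproof : (val : proj_range P -> H) \in bounded_linear_pred.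
Proof.
apply: (@bounded_linear_mem _ _ _ _ 1) => [c x y|x] //.
by rewrite mul1r range_normE.
Qed.

Lemma range_corestr_subproof : range_corestr \in bounded_linear_pred.
Proof.
have [M _ PM] := bounded_op_bound P.
apply: (@bounded_linear_mem _ _ _ _ M) => [c x y|x].
  by apply: val_inj; rewrite /= bopD bopZ.
by rewrite range_normE PM.
Qed.

Definition op_incl : bounded_op (proj_range P) H :=
  @BoundedOp R (proj_range P) H _ range_incl_subproof.
Definition op_corestr := BoundedOp range_corestr range_corestr_subproof.

Lemma projection_idemE (x : H) : P (P x) = P x.
Proof. by rewrite -[LHS]/((P \bo P) x) projection_idem. Qed.

End RangeOperators.

(** * Separability and infinite dimension of sums and ranges *)

Section SeparableInfinite.
Context {R : realType}.
Implicit Types H : hilbertType R.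

Lemma separable_surj H1 H2 (T : bounded_op H1 H2) :
  (forall y, exists x, T x = y) -> separable_space H1 -> separable_space H2.
Proof.
move=> Ts [S cS dS]; exists (T @` S); first exact: card_le_trans (card_image_le _ _) cS.
move=> O [y Oy] oO; have [x xy] := Ts y.
have [s [Os Ss]] : (T @^-1` O `&` S) !=set0.
  apply: dS; first by exists x; rewrite /= xy.
  by apply: open_comp => // z _; exact: op_continuous.
by exists (T s); split=> //; exists s.
Qed.

Lemma infinite_dimensional_surj H1 H2 (T : bounded_op H1 H2) :
  (forall y, exists x, T x = y) -> infinite_dimensional H2 -> infinite_dimensional H1.
Proof.
move=> Ts iH n e; have [y ye] := iH n (fun i => T (e i)).
have [x xy] := Ts y; exists x => c xe; apply: (ye c).
by rewrite -xy xe bop_sum; apply: eq_bigr => i _; rewrite bopZ.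
Qed.

Lemma separable_dsum H1 H2 :
  separable_space H1 -> separable_space H2 -> separable_space (dsum H1 H2).
Proof.
move=> [S1 cS1 dS1] [S2 cS2 dS2].
exists (S1 `*` S2 : set (dsum H1 H2)); first exact: countableX.
move=> O [x Ox] oO; have /nbhs_ballP[d /= d0 dO] := open_nbhs_nbhs (conj oO Ox).
have d2 : 0 < d / 2 by rewrite divr_gt0.
have [s [xs Ss]] : (ball x.1 (d / 2) `&` S1) !=set0.
  by apply: dS1; [exists x.1; exact: ballxx|exact: ball_open].
have [t [xt St]] : (ball x.2 (d / 2) `&` S2) !=set0.
  by apply: dS2; [exists x.2; exact: ballxx|exact: ball_open].
exists ((s, t) : dsum H1 H2); split=> //; apply: dO.
move: xs xt; rewrite -!ball_normE/= => xs xt.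
by rewrite (le_lt_trans (dsum_norm_le _))// [d]splitr ltrD.
Qed.

Lemma sid_dsum H1 H2 : sid H1 -> separable_space H2 -> sid (dsum H1 H2).
Proof.
move=> [s1 i1] s2; split; first exact: separable_dsum.
by apply: (infinite_dimensional_surj (T := op_fst)) i1 => y; exists (y, 0).
Qed.

Lemma separable_range H (P : projection H) :
  separable_space H -> separable_space (proj_range P).
Proof.
apply: (separable_surj (T := op_corestr P)) => y; exists (val y).
by apply: val_inj; rewrite /= proj_rangeE.
Qed.

Lemma sid_range_proj_dsum H1 H2 (P : projection H1) (Q : projection H2) :
  separable_space H1 -> separable_space H2 -> sid (proj_range P) ->
  sid (proj_range (proj_dsum P Q)).
Proof.
move=> s1 s2 [_ iP]; split; first exact/separable_range/separable_dsum.
apply: (infinite_dimensional_surj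
  (T := op_corestr P \bo op_fst \bo op_incl (proj_dsum P Q))) iP => y.
have yP : ((val y, 0) : dsum H1 H2) \in range_pred (proj_dsum P Q).
  by rewrite unfold_in; apply/eqP; apply: dsum_eq; rewrite /= ?bop0 ?proj_rangeE.
by exists (ProjRange _ _ yP); apply: val_inj; rewrite /= proj_rangeE.
Qed.

End SeparableInfinite.

(** * Compact operators *)

Section Compact.
Context {R : realType}.

(** [B] maps the unit ball into the ball of radius [M + 1], so the image under the composite lies in
    the compact set [C]. The bound [M + 1] replaces [M] because it is divided by. *)
Lemma compact_op_comp (V1 V2 V3 V4 : normedModType R[i]) (A : bounded_op V3 V4)
  (T : bounded_op V2 V3) (B : bounded_op V1 V2) :
  compact_op T -> compact_op (A \bo T \bo B).
Proof.
rewrite /compact_op !precompactE => cT.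
have [M M0 BM] := bounded_op_bound B.
pose C := (fun y => (M + 1)%:C *: A y) @` closure (T @` [set x | `|x| <= 1]).
have cC : compact C.
  apply: continuous_compact cT; apply: continuous_subspaceT => y.
  by apply: cvgZl_tmp; exact: op_continuous.
have clC : closed C by apply: compact_closed cC; exact: norm_hausdorff.
apply: (subclosed_compact _ cC); first exact: closed_closure.
rewrite [X in _ `<=` X](closure_id C).1//; apply: closure_subset.
move=> _ [x /= x1 <-].
have M1 : M + 1 != 0 by rewrite gt_eqF// ltr_wpDl.
exists (T ((M + 1)%:C^-1 *: B x)).
  apply: subset_closure; exists ((M + 1)%:C^-1 *: B x) => //=.
  rewrite normrZ -fmorphV ger0_norm ?lecR ?invr_ge0 ?addr_ge0// fmorphV.
  rewrite mulrC ler_pdivrMr ?mul1r ?ltcR ?ltr_wpDl//.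
  rewrite (le_trans (BM _))// (le_trans (ler_wpM2l _ x1)) ?lecR// mulr1.
  by rewrite lecR lerDl.
rewrite !bopZ scalerA divff ?scale1r// (_ : 0 = 0%:C)//.
by rewrite (inj_eq (@complexI R)).
Qed.

Lemma compact_op0 (V W : normedModType R[i]) : compact_op (0 : bounded_op V W).
Proof.
apply: (@precompact_subset _ _ [set 0]) => [_ [x _ <-]//|].
by apply: compact_precompact; [exact: norm_hausdorff|exact: compact_set1].
Qed.

End Compact.

(** * The operator ideal transported to other Hilbert spaces *)

Section IdealFactor.
Context {R : realType} {H : hilbertType R} (K : frechet_ideal H).

(* The condition to lie in the ideal, in a form that makes sense between
   different spaces and is visibly stable under composition. *)
Definition ideal_factor (V W : normedModType R[i]) (T : bounded_op V W) : Prop :=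
  exists (k : K) (A : bounded_op H W) (B : bounded_op V H),
    T = A \bo ideal_op k \bo B.

Lemma ideal_factor_comp (V1 V2 V3 V4 : normedModType R[i]) (A : bounded_op V3 V4)
  (T : bounded_op V2 V3) (B : bounded_op V1 V2) :
  ideal_factor T -> ideal_factor (A \bo T \bo B).
Proof.
move=> [k [A' [B' ->]]]; exists k, (A \bo A'), (B' \bo B).
exact: bounded_op_ext.
Qed.

Lemma ideal_opB (k l : K) : ideal_op (k - l) = ideal_op k - ideal_op l.
Proof.
by rewrite addrC -scaleN1r ideal_op_linear scaleN1r addrC.
Qed.

Lemma ideal_op0 : ideal_op (0 : K) = 0.
Proof. by rewrite -(subrr 0) ideal_opB subrr. Qed.

Lemma ideal_factor0 (V W : normedModType R[i]) : ideal_factor (0 : bounded_op V W).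
Proof.
by exists 0, 0, 0; rewrite ideal_op0; apply: bounded_op_ext => x.
Qed.

Lemma ideal_factorN (V W : normedModType R[i]) (T : bounded_op V W) :
  ideal_factor T -> ideal_factor (- T).
Proof.
move=> [k [A [B ->]]]; exists k, (- A), B; exact: bounded_op_ext.
Qed.

Lemma unitary_adjE (V W : hilbertType R) (U : unitary V W) x :
  unitary_adj U (U x) = x.
Proof. by rewrite -[LHS]/((unitary_adj U \bo U) x) unitary_adjK. Qed.

Lemma unitary_KadjE (V W : hilbertType R) (U : unitary V W) x :
  U (unitary_adj U x) = x.
Proof. by rewrite -[LHS]/((U \bo unitary_adj U) x) unitary_Kadj. Qed.

Hypothesis hH : sid H.

(** Conversely to the evident direction, any unitary from [V] to [H] is absorbed into the outer
    factors, and [ideal_mul] supplies the element of [K]. *)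
Lemma in_idealP (V : hilbertType R) (T : bounded_op V V) :
  sid V -> in_ideal K T <-> ideal_factor T.
Proof.
move=> hV; split=> [[U [k _ kT]]|[k [A [B TE]]]].
  exists k, (unitary_adj U), U; rewrite kT.
  by apply: bounded_op_ext => x /=; rewrite !unitary_adjE.
have [U _] := unitary_exists hV hH; exists U.
exists (ideal_mul (U \bo A) k (B \bo unitary_adj U)) => //.
by rewrite ideal_mulE TE; exact: bounded_op_ext.
Qed.

(** The two factorizations have unrelated outer factors. Moved to [H] by the same pair of unitaries,
    both operators become elements of [K], where they are subtracted. *)
Lemma ideal_factorB (V W : hilbertType R) (S T : bounded_op V W) :
  sid V -> sid W -> ideal_factor S -> ideal_factor T -> ideal_factor (S - T).
Proof.
move=> /unitary_exists/(_ hH)[U _] /unitary_exists/(_ hH)[U' _].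
move=> [k [A [B ->]]] [l [C [D ->]]].
exists (ideal_mul (U' \bo A) k (B \bo unitary_adj U)
  - ideal_mul (U' \bo C) l (D \bo unitary_adj U)), (unitary_adj U'), U.
rewrite ideal_opB !ideal_mulE; apply: bounded_op_ext => x /=.
rewrite -[in RHS]/(unitary_adj U' (_ (U x) - _ (U x))).
by rewrite bopB /= !unitary_adjE.
Qed.

Lemma ideal_factorD (V W : hilbertType R) (S T : bounded_op V W) :
  sid V -> sid W -> ideal_factor S -> ideal_factor T -> ideal_factor (S + T).
Proof.
by move=> hV hW iS iT; rewrite -[T]opprK; apply: ideal_factorB => //; exact: ideal_factorN.
Qed.

Lemma ideal_factor_dsum (V W : hilbertType R) (S : bounded_op V V) (T : bounded_op W W) :
  sid V -> sid W -> ideal_factor S -> ideal_factor T -> ideal_factor (op_dsum S T).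
Proof.
move=> hV hW iS iT; have hVW := sid_dsum hV hW.1.
by rewrite op_dsumE; apply: ideal_factorD => //; exact: ideal_factor_comp.
Qed.

End IdealFactor.

(** * Construction of unitaries from mutually inverse adjoint maps *)

Section Unitaries.
Context {R : realType}.
Implicit Types V W : hilbertType R.

(** Linearity follows from the adjoint relation since inner products separate vectors; [f] is
    isometric since [ip (f x) (f x) = ip x (g (f x)) = ip x x]. *)
Lemma unitary_of V W (f : V -> W) (g : W -> V) :
  (forall x y, ip (f x) y = ip x (g y)) -> cancel f g -> cancel g f ->
  exists U : unitary V W, U =1 f /\ unitary_adj U =1 g.
Proof.
move=> fg fK gK.
have gf x y : ip (g x) y = ip x (f y) by rewrite ipC -fg -ipC.
have mem V' W' (h : V' -> W') (k : W' -> V') :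
    (forall x y, ip (h x) y = ip x (k y)) -> cancel h k -> h \in bounded_linear_pred.
  move=> hk hK; apply: (@bounded_linear_mem _ _ _ _ 1) => [c x y|x].
    by apply: ip_ext => z; rewrite hk ipDl ipZl ipDl ipZl !hk.
  by rewrite mul1r -(@ler_pXn2r _ 2)// ?nnegrE// -!ip_norm hk hK.
unshelve eexists.
  apply: (@Unitary _ _ _ (BoundedOp f (mem _ _ _ _ fg fK))
    (BoundedOp g (mem _ _ _ _ gf gK))).
  - exact: fg.
  - by apply: bounded_op_ext => x /=; rewrite fK.
  - by apply: bounded_op_ext => x /=; rewrite gK.
by [].
Qed.

Lemma unitary_adj_sym V W (U : unitary V W) x y :
  ip (unitary_adj U x) y = ip x (U y).
Proof. by rewrite ipC -unitary_adjP -ipC. Qed.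

End Unitaries.

(** * Unitary equivalence modulo the ideal *)

Section CpEquiv.
Context {R : realType} {H : hilbertType R} (K : frechet_ideal H).
Hypothesis hH : sid H.
Context {A : Type}.
Implicit Types V W : hilbertType R.

(** Stated for arbitrary families of operators, so that direct sums and representations can be
    compared without being presented as compressions. *)
Definition cp_equiv V W (phi : A -> bounded_op V V) (psi : A -> bounded_op W W) :=
  exists U : unitary V W, forall a,
    ideal_factor K (phi a - (unitary_adj U \bo psi a \bo U)).

Lemma cp_equiv_conj V W (phi : A -> bounded_op V V) (psi : A -> bounded_op W W)
  (f : V -> W) (g : W -> V) :
  (forall x y, ip (f x) y = ip x (g y)) -> cancel f g -> cancel g f ->
  (forall a x, phi a x = g (psi a (f x))) -> cp_equiv phi psi.
Proof.
move=> fg fK gK E; have [U [Uf Ug]] := unitary_of fg fK gK.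
exists U => a; rewrite (_ : _ - _ = 0); first exact: ideal_factor0.
apply/eqP; rewrite subr_eq0; apply/eqP/bounded_op_ext => x /=.
by rewrite Uf Ug E.
Qed.

Lemma cp_equiv_refl V (phi : A -> bounded_op V V) : cp_equiv phi phi.
Proof. exact: (@cp_equiv_conj _ _ _ _ id id). Qed.

Lemma cp_equiv_sym V W (phi : A -> bounded_op V V) (psi : A -> bounded_op W W) :
  cp_equiv phi psi -> cp_equiv psi phi.
Proof.
move=> [U UK].
have [V' [Vf Vg]] := unitary_of (unitary_adj_sym U) (unitary_KadjE U) (unitary_adjE U).
exists V' => a.
rewrite (_ : _ - _ = - (U \bo (phi a - (unitary_adj U \bo psi a \bo U))
    \bo unitary_adj U)); first exact/ideal_factorN/ideal_factor_comp.
apply: bounded_op_ext => x.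
rewrite -[RHS]/(- U (phi a (unitary_adj U x)
  - unitary_adj U (psi a (U (unitary_adj U x))))).
rewrite -[LHS]/(psi a x - unitary_adj V' (phi a (V' x))) Vf Vg.
by rewrite bopB !unitary_KadjE opprB.
Qed.

Lemma cp_equiv_trans V1 V2 V3 (phi1 : A -> bounded_op V1 V1)
  (phi2 : A -> bounded_op V2 V2) (phi3 : A -> bounded_op V3 V3) :
  sid V1 -> cp_equiv phi1 phi2 -> cp_equiv phi2 phi3 -> cp_equiv phi1 phi3.
Proof.
move=> sV [U UK] [V VK].
have fg x y : ip (V (U x)) y = ip x (unitary_adj U (unitary_adj V y)).
  by rewrite !unitary_adjP.
have [W [Wf Wg]] := unitary_of fg
  (can_comp (unitary_adjE V) (unitary_adjE U))
  (can_comp (unitary_KadjE U) (unitary_KadjE V)).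
exists W => a.
rewrite (_ : _ - _ = (phi1 a - (unitary_adj U \bo phi2 a \bo U)) +
   (unitary_adj U \bo (phi2 a - (unitary_adj V \bo phi3 a \bo V)) \bo U)).
  by apply: ideal_factorD => //; exact: ideal_factor_comp.
apply: bounded_op_ext => x.
rewrite -[LHS]/(phi1 a x - unitary_adj W (phi3 a (W x))) Wf Wg.
rewrite -[RHS]/(phi1 a x - unitary_adj U (phi2 a (U x)) +
  unitary_adj U (phi2 a (U x) - unitary_adj V (phi3 a (V (U x))))).
by rewrite bopB addrA subrK.
Qed.

Lemma cp_equiv_dsum V1 V2 W1 W2 (phi1 : A -> bounded_op V1 V1)
  (phi2 : A -> bounded_op V2 V2) (psi1 : A -> bounded_op W1 W1)
  (psi2 : A -> bounded_op W2 W2) : sid V1 -> sid V2 ->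
  cp_equiv phi1 psi1 -> cp_equiv phi2 psi2 ->
  cp_equiv (fun a => op_dsum (phi1 a) (phi2 a)) (fun a => op_dsum (psi1 a) (psi2 a)).
Proof.
move=> s1 s2 [U UK] [V VK].
pose f (x : dsum V1 V2) : dsum W1 W2 := (U x.1, V x.2).
pose g (x : dsum W1 W2) : dsum V1 V2 := (unitary_adj U x.1, unitary_adj V x.2).
have fg x y : ip (f x) y = ip x (g y) by congr (_ + _); exact: unitary_adjP.
have fK : cancel f g by move=> x; apply: dsum_eq; rewrite /= unitary_adjE.
have gK : cancel g f by move=> x; apply: dsum_eq; rewrite /= unitary_KadjE.
have [W [Wf Wg]] := unitary_of fg fK gK; exists W => a.
rewrite (_ : _ - _ = op_dsum (phi1 a - (unitary_adj U \bo psi1 a \bo U))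
  (phi2 a - (unitary_adj V \bo psi2 a \bo V))).
  exact: ideal_factor_dsum.
apply: bounded_op_ext => x.
by rewrite -[LHS]/(_ - unitary_adj W (op_dsum (psi1 a) (psi2 a) (W x))) Wf Wg.
Qed.

Lemma cp_equiv_dsumC V W (phi : A -> bounded_op V V) (psi : A -> bounded_op W W) :
  cp_equiv (fun a => op_dsum (phi a) (psi a)) (fun a => op_dsum (psi a) (phi a)).
Proof.
pose swap V W (x : dsum V W) : dsum W V := (x.2, x.1).
apply: (@cp_equiv_conj _ _ _ _ (swap V W) (swap W V)) => // [x y|[] //|[] //].
exact: addrC.
Qed.

Lemma cp_equiv_dsumA V1 V2 V3 (phi1 : A -> bounded_op V1 V1)
  (phi2 : A -> bounded_op V2 V2) (phi3 : A -> bounded_op V3 V3) :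
  cp_equiv (fun a => op_dsum (phi1 a) (op_dsum (phi2 a) (phi3 a)))
    (fun a => op_dsum (op_dsum (phi1 a) (phi2 a)) (phi3 a)).
Proof.
pose f (x : dsum V1 (dsum V2 V3)) : dsum (dsum V1 V2) V3 := ((x.1, x.2.1), x.2.2).
pose g (x : dsum (dsum V1 V2) V3) : dsum V1 (dsum V2 V3) := (x.1.1, (x.1.2, x.2)).
apply: (@cp_equiv_conj _ _ _ _ f g) => // [x y|[? []]//|[[]]//].
exact/esym/addrA.
Qed.

End CpEquiv.

(** * Direct sums of extensions *)

Section ExtensionMonoid.
Context {R : realType} {H : hilbertType R} (K : frechet_ideal H).
Hypothesis hH : sid H.
Context {A : smooth_algebra R}.
Local Notation inc := (@smooth_incl R A).
Implicit Types (p q : ext_pair A) (x y z d : tau_extension K A).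

Definition smooth_cp p (a : A) := cp_map p (inc a).

Lemma unitarily_equivalentP p q : sid (proj_range (pair_proj p)) ->
  unitarily_equivalent K p q <-> cp_equiv K (smooth_cp p) (smooth_cp q).
Proof.
by move=> sp; split=> -[U UK]; exists U => a; have := UK a; rewrite in_idealP.
Qed.

Lemma rep0 (B : cstarAlgType R) (V : hilbertType R) (pi : star_rep B V) : pi 0 = 0.
Proof.
by rewrite -[X in pi X](subrr 0) -scaleN1r addrC rep_linear scaleN1r addNr.
Qed.

Lemma noncompactP p :
  (forall a, compact_op (pair_proj p \bo pair_rep p a \bo pair_proj p) ->
     pair_proj p \bo pair_rep p a \bo pair_proj p = 0) <->
  [set pair_proj p \bo pair_rep p a \bo pair_proj p | a in setT]
    `&` [set T | compact_op T] = [set 0].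
Proof.
split=> [h|h a ca].
  apply/seteqP; split=> [_ [[a _ <-] /h//]|_ ->]; split; last exact: compact_op0.
  by exists 0 => //; rewrite rep0; apply: bounded_op_ext => x /=; rewrite bop0.
suff : [set 0] (pair_proj p \bo pair_rep p a \bo pair_proj p) by [].
by rewrite -h; split=> //; exists a.
Qed.

Lemma ext_sid x : sid (proj_range (pair_proj x)).
Proof. by have [] := ext_smooth x. Qed.

(** If the compression for the sum is compact, so are its two diagonal corners, which therefore
    vanish. *)
Lemma pair_dsum_smooth p q : tau_smooth K p -> tau_smooth K q ->
  tau_smooth K (pair_dsum p q).
Proof.
move=> [sp rp cp /noncompactP np] [sq rq cq /noncompactP nq].
have spq := sid_dsum sp sq.1.
split=> //=.
- exact: sid_range_proj_dsum sp.1 sq.1 rp.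
- move=> a; apply/(in_idealP K hH _ spq).
  rewrite (_ : commutator _ _ = op_dsum
    (commutator (pair_rep p (inc a)) (pair_proj p))
    (commutator (pair_rep q (inc a)) (pair_proj q))); last exact: bounded_op_ext.
  by apply: ideal_factor_dsum => //; apply/in_idealP.
apply/(noncompactP (pair_dsum p q)) => a ca.
have := compact_op_comp op_fst op_inl ca.
rewrite (_ : _ \bo _ = pair_proj p \bo pair_rep p a \bo pair_proj p); last first.
  exact: bounded_op_ext.
move=> /np/(congr1 (fun T : bounded_op _ _ => T : _ -> _)) p0.
have := compact_op_comp op_snd op_inr ca.
rewrite (_ : _ \bo _ = pair_proj q \bo pair_rep q a \bo pair_proj q); last first.
  exact: bounded_op_ext.
move=> /nq/(congr1 (fun T : bounded_op _ _ => T : _ -> _)) q0.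
apply: bounded_op_ext => v; apply: dsum_eq.
  by have := congr1 (fun T => T v.1) p0.
by have := congr1 (fun T => T v.2) q0.
Qed.

(** The sum is tau-smooth, so the default branch of [ext_dsum] is never taken. *)
Lemma ext_dsumE x y : ext_dsum x y = pair_dsum x y :> ext_pair A.
Proof.
rewrite /ext_dsum; case: pselect => // h; exfalso; apply: h.
by apply: pair_dsum_smooth; exact: ext_smooth.
Qed.

(** The range of [proj_dsum P Q] and the sum of the two ranges are distinct types; [f] and [g]
    identify them and conjugate the two families exactly. *)
Lemma smooth_cp_dsum p q : cp_equiv K (smooth_cp (pair_dsum p q))
  (fun a => op_dsum (smooth_cp p a) (smooth_cp q a)).
Proof.
pose P := pair_proj p; pose Q := pair_proj q.
pose f (x : proj_range (proj_dsum P Q)) : dsum (proj_range P) (proj_range Q) :=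
  (op_corestr P (val x).1, op_corestr Q (val x).2).
pose g0 (x : dsum (proj_range P) (proj_range Q)) : dsum _ _ := (val x.1, val x.2).
pose g v : proj_range (proj_dsum P Q) := op_corestr (proj_dsum P Q) (g0 v).
have fK : cancel f g.
  move=> x; apply: val_inj; rewrite -[RHS]proj_rangeE.
  by apply: dsum_eq; rewrite /= projection_idemE.
have gK : cancel g f.
  by move=> x; apply: dsum_eq; apply: val_inj; rewrite /= !proj_rangeE.
apply: (@cp_equiv_conj _ _ _ _ _ _ _ _ f g) => //.
- move=> x y; congr (_ + _).
    exact: (projection_sa P (val x).1 (val y.1)).
  exact: (projection_sa Q (val x).2 (val y.2)).
move=> a x; apply: val_inj; apply: dsum_eq => /=.
  have -> : P (val x).1 = (val x).1 by rewrite -[in RHS]proj_rangeE.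
  by rewrite projection_idemE.
have -> : Q (val x).2 = (val x).2 by rewrite -[in RHS]proj_rangeE.
by rewrite projection_idemE.
Qed.

End ExtensionMonoid.

(** * The identity projection and the zero representation *)

Section IdentityProjection.
Context {R : realType}.

Lemma op_id_adj (V : hilbertType R) : is_adjoint (@op_id R V) op_id.
Proof. by []. Qed.

Lemma op_id_idem (V : hilbertType R) : op_id \bo op_id = @op_id R V.
Proof. exact: bounded_op_ext. Qed.

Definition id_proj (V : hilbertType R) : projection V :=
  Projection (@op_id_idem V) (@op_id_adj V).

Lemma sid_range_id (V : hilbertType R) (P : projection V) :
  P = op_id :> bounded_op _ _ -> sid V -> sid (proj_range P).
Proof.
move=> P1 [sV iV]; split; first exact: separable_range.
apply: (infinite_dimensional_surj (T := op_incl P)) iV => y.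
have yP : y \in range_pred P by rewrite unfold_in P1.
by exists (ProjRange P y yP).
Qed.

Lemma zero_rep_linear (B : cstarAlgType R) (V : hilbertType R) :
  linear (fun _ : B => (0 : bounded_op V V)).
Proof. by move=> c a b; rewrite scaler0 addr0. Qed.

Lemma zero_repM (B : cstarAlgType R) (V : hilbertType R) (a b : B) :
  0 = (0 : bounded_op V V) \bo (0 : bounded_op V V).
Proof. exact: bounded_op_ext. Qed.

Lemma zero_repS (B : cstarAlgType R) (V : hilbertType R) (a : B) :
  is_adjoint (0 : bounded_op V V) 0.
Proof. by move=> x y; rewrite ip0l ip0r. Qed.

Definition zero_rep (B : cstarAlgType R) (V : hilbertType R) : star_rep B V :=
  StarRep (@zero_rep_linear B V) (@zero_repM B V) (@zero_repS B V).

End IdentityProjection.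

(** * Stable equivalence and the monoid of classes *)

Section StableEquivalence.
Context {R : realType} {H : hilbertType R} (K : frechet_ideal H).
Hypothesis hH : sid H.
Context {A : smooth_algebra R}.
Implicit Types (x y z d e : tau_extension K A).
Local Notation "x ≈ y" := (unitarily_equivalent K (ext_pair_of x) (ext_pair_of y))
  (at level 70).
Local Notation "x ⊕ y" := (ext_dsum x y) (at level 50, left associativity).

Lemma ueP x y : x ≈ y <-> cp_equiv K (smooth_cp x) (smooth_cp y).
Proof. by apply: unitarily_equivalentP => //; exact: ext_sid. Qed.

Lemma ue_refl x : x ≈ x.
Proof. by apply/ueP; exact: cp_equiv_refl. Qed.

Lemma ue_sym x y : x ≈ y -> y ≈ x.
Proof. by move=> /ueP xy; apply/ueP; exact: cp_equiv_sym. Qed.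

Lemma ue_trans y x z : x ≈ y -> y ≈ z -> x ≈ z.
Proof.
move=> /ueP xy /ueP yz; apply/ueP.
by apply: cp_equiv_trans xy yz => //; exact: ext_sid.
Qed.

Lemma cp_dsum x y : cp_equiv K (smooth_cp (x ⊕ y))
  (fun a => op_dsum (smooth_cp x a) (smooth_cp y a)).
Proof. by rewrite ext_dsumE//; exact: smooth_cp_dsum. Qed.

Lemma sid_cp_dsum x y :
  sid (dsum (proj_range (pair_proj x)) (proj_range (pair_proj y))).
Proof. by apply: sid_dsum; [exact: ext_sid|exact: (ext_sid y).1]. Qed.

Lemma ue_dsum x x' y y' : x ≈ x' -> y ≈ y' -> x ⊕ y ≈ x' ⊕ y'.
Proof.
move=> /ueP xx /ueP yy; apply/ueP.
apply: (cp_equiv_trans hH _ (cp_dsum x y)); first exact: ext_sid.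
apply: (cp_equiv_trans hH _ _ (cp_equiv_sym (cp_dsum x' y'))); first exact: sid_cp_dsum.
by apply: cp_equiv_dsum => //; exact: ext_sid.
Qed.

Lemma ue_dsumC x y : x ⊕ y ≈ y ⊕ x.
Proof.
apply/ueP; apply: (cp_equiv_trans hH _ (cp_dsum x y)); first exact: ext_sid.
apply: (cp_equiv_trans hH _ _ (cp_equiv_sym (cp_dsum y x))); first exact: sid_cp_dsum.
exact: cp_equiv_dsumC.
Qed.

Lemma ue_dsumA x y z : x ⊕ (y ⊕ z) ≈ x ⊕ y ⊕ z.
Proof.
have s1 := ext_sid x; have s2 := ext_sid y; have s3 := ext_sid z.
have s23 := sid_cp_dsum y z; have s12 := sid_cp_dsum x y.
apply/ueP; apply: (cp_equiv_trans hH _ (cp_dsum _ _)); first exact: ext_sid.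
apply: (cp_equiv_trans hH _ (cp_equiv_dsum hH s1 (ext_sid _)
  (cp_equiv_refl _ _) (cp_dsum _ _))); first exact: sid_cp_dsum.
apply: (cp_equiv_trans hH _ (cp_equiv_dsumA _ _ _ _)).
  exact: (sid_dsum s1 s23.1).
apply: (cp_equiv_trans hH _ _ (cp_equiv_sym (cp_dsum _ _))).
  exact: (sid_dsum s12 s3.1).
by apply: cp_equiv_dsum => //; [exact/cp_equiv_sym/cp_dsum|exact: cp_equiv_refl].
Qed.

Lemma ue_dsumAC x y z : x ⊕ y ⊕ z ≈ x ⊕ z ⊕ y.
Proof.
apply: (ue_trans (ue_sym (ue_dsumA _ _ _))).
apply: ue_trans (ue_dsumA _ _ _).
by apply: ue_dsum; [exact: ue_refl|exact: ue_dsumC].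
Qed.

Lemma ue_dsumACA x y z t : (x ⊕ y) ⊕ (z ⊕ t) ≈ (x ⊕ z) ⊕ (y ⊕ t).
Proof.
apply: (ue_trans (ue_dsumA _ _ _)).
apply: ue_trans (ue_sym (ue_dsumA _ _ _)).
by apply: ue_dsum; [exact: ue_dsumAC|exact: ue_refl].
Qed.

Local Notation degenerate := (degenerate K).

Lemma degenerate_id d : pair_proj d = op_id :> bounded_op _ _ -> degenerate d.
Proof. by move=> d1; exists d; split=> //; exact: ue_refl. Qed.

Lemma degenerate_dsum d e : degenerate d -> degenerate e -> degenerate (d ⊕ e).
Proof.
move=> [x [x1 dx]] [y [y1 ey]]; exists (x ⊕ y); split; last exact: ue_dsum.
rewrite ext_dsumE//=; apply: bounded_op_ext => v.
by apply: dsum_eq; rewrite /= ?x1 ?y1.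
Qed.

Lemma zero_pair_smooth :
  tau_smooth K (ExtPair (zero_rep (smooth_cstar A) H) (id_proj H)).
Proof.
split=> //=.
- exact: (sid_range_id (P := id_proj H)).
- move=> a; apply/in_idealP => //.
  rewrite (_ : commutator _ _ = 0); first exact: ideal_factor0.
  by apply: bounded_op_ext => v; exact: subrr.
- apply/(noncompactP (ExtPair (zero_rep _ H) (id_proj H))) => a _.
  exact: bounded_op_ext.
Qed.

Definition zero_ext : tau_extension K A := TauExtension zero_pair_smooth.

Lemma degenerate_zero : degenerate zero_ext.
Proof. exact: degenerate_id. Qed.

(** Replaces [pair_dsum] by [ext_dsum], so that the rules for sums of extensions apply. *)
Lemma stableP x y : stably_equivalent x y <->
  exists d e, [/\ degenerate d, degenerate e & x ⊕ d ≈ y ⊕ e].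
Proof. by split=> -[d [e [dd de]]] h; exists d, e; split; rewrite // !ext_dsumE// in h *. Qed.

Lemma stable_ue x y : x ≈ y -> stably_equivalent x y.
Proof.
move=> xy; apply/stableP; exists zero_ext, zero_ext.
by split; [exact: degenerate_zero..|apply: ue_dsum => //; exact: ue_refl].
Qed.

Lemma stable_refl x : stably_equivalent x x.
Proof. exact/stable_ue/ue_refl. Qed.

Lemma stable_sym x y : stably_equivalent x y -> stably_equivalent y x.
Proof.
by move=> /stableP[d [e [dd de h]]]; apply/stableP; exists e, d; split=> //; exact: ue_sym.
Qed.

(** Add [d'] to the first equivalence and [e] to the second; both then pass through [y ⊕ e ⊕ d'], up
    to order. *)
Lemma stable_trans y x z :
  stably_equivalent x y -> stably_equivalent y z -> stably_equivalent x z.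
Proof.
move=> /stableP[d [e [dd de xy]]] /stableP[d' [e' [dd' de' yz]]].
apply/stableP; exists (d ⊕ d'), (e' ⊕ e); split; [exact: degenerate_dsum..|].
apply: (ue_trans (ue_dsumA _ _ _)).
apply: (ue_trans (ue_dsum xy (ue_refl _))).
apply: (ue_trans (ue_dsumAC _ _ _)).
apply: (ue_trans (ue_dsum yz (ue_refl _))).
exact/ue_sym/ue_dsumA.
Qed.

Lemma stable_dsum x x' y y' : stably_equivalent x x' -> stably_equivalent y y' ->
  stably_equivalent (x ⊕ y) (x' ⊕ y').
Proof.
move=> /stableP[d [e [dd de xx]]] /stableP[d' [e' [dd' de' yy]]].
apply/stableP; exists (d ⊕ d'), (e ⊕ e'); split; [exact: degenerate_dsum..|].
apply: (ue_trans (ue_dsumACA _ _ _ _)).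
apply: ue_trans (ue_dsumACA _ _ _ _).
exact: ue_dsum.
Qed.

(** Each one serves as the degenerate summand added to the other. *)
Lemma stable_degenerate d e : degenerate d -> degenerate e -> stably_equivalent d e.
Proof.
by move=> dd de; apply/stableP; exists e, d; split=> //; exact: ue_dsumC.
Qed.

Lemma stable_dsum0 d x : degenerate d -> stably_equivalent (d ⊕ x) x.
Proof.
move=> dd; apply/stableP; exists zero_ext, (d ⊕ zero_ext); split.
- exact: degenerate_zero.
- by apply: degenerate_dsum => //; exact: degenerate_zero.
apply: (ue_trans (ue_dsum (ue_dsumC _ _) (ue_refl _))).
exact/ue_sym/ue_dsumA.
Qed.

Lemma ext_eqP (X Y : Ext K A) : (X : _ -> Prop) = Y -> X = Y.
Proof.
case: X Y => [X hX] [Y hY] /= XY; rewrite XY in hX *.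
by congr MkExt; exact: Prop_irrelevance.
Qed.

Lemma ext_class_eq x y : ext_class x = ext_class y <-> stably_equivalent x y.
Proof.
split=> [/(congr1 (fun X : Ext K A => ext_set X y))/= ->|xy]; first exact: stable_refl.
apply: ext_eqP; apply/funext => z; apply/propext; split; last exact: stable_trans.
exact: (stable_trans (stable_sym xy)).
Qed.

Lemma ext_reprK (X : Ext K A) : ext_class (ext_repr X) = X.
Proof. by apply: ext_eqP; rewrite /ext_repr; case: cid. Qed.

Lemma ext_class_repr x : stably_equivalent (ext_repr (ext_class x)) x.
Proof. by apply/ext_class_eq; rewrite ext_reprK. Qed.

(** [ext_add] works on chosen representatives; by [stable_dsum] the choice does not affect the
    class. *)
Lemma ext_add_class x y : ext_add (ext_class x) (ext_class y) = ext_class (x ⊕ y).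
Proof. by apply/ext_class_eq/stable_dsum; exact: ext_class_repr. Qed.

End StableEquivalence.

(** * Differences of nested projections *)

Section ComplementProjection.
Context {R : realType} {V : hilbertType R}.

Lemma projection_fixed_adj (P : projection V) x y : ip (P x) y = ip x (P y).
Proof. exact: projection_sa. Qed.

Definition sub_op (E P : bounded_op V V) : bounded_op V V := E - P.

Lemma sub_proj_idem (E P : projection V) : (forall v, E (P v) = P v) ->
  (forall v, P (E v) = P v) -> sub_op E P \bo sub_op E P
    = sub_op E P.
Proof.
move=> EP PE; apply: bounded_op_ext => v.
rewrite -[LHS]/(E (E v - P v) - P (E v - P v)).
by rewrite !bopB !projection_idemE EP PE subrr subr0.
Qed.

Lemma sub_proj_adj (E P : projection V) :
  is_adjoint (sub_op E P) (sub_op E P).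
Proof.
move=> x y; rewrite -[LHS]/(ip (E x - P x) y) -[RHS]/(ip x (E y - P y)).
by rewrite ipBl ipBr !projection_fixed_adj.
Qed.

Definition sub_proj (E P : projection V) (EP : forall v, E (P v) = P v)
  (PE : forall v, P (E v) = P v) : projection V :=
  Projection (sub_proj_idem EP PE) (sub_proj_adj E P).

End ComplementProjection.

(** * The smallest reducing subspace containing the range of [P] *)

Section ReducingProjection.
Context {R : realType} {V : hilbertType R} {B : cstarAlgType R}.
Variables (pi : star_rep B V) (P : projection V).

Lemma repME a b v : pi (amul a b) v = pi a (pi b v).
Proof. by rewrite repM. Qed.

(* The complement of the smallest reducing subspace containing the range of P;
   describing it by equations avoids closed linear spans. *)
Definition null_space : set V :=
  [set v | P v = 0 /\ forall b, P (pi b v) = 0].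

Lemma null_space_closed : closed null_space.
Proof.
have ck (T : bounded_op V V) : closed [set v | T v = 0].
  apply: (@closed_comp _ _ T [set 0]) => [v _|]; first exact: op_continuous.
  by apply: accessible_closed_set1; apply: hausdorff_accessible; exact: norm_hausdorff.
rewrite (_ : null_space = [set v | P v = 0] `&`
    \bigcap_b [set v | (P \bo pi b) v = 0]).
  by apply: closedI => //; apply: closed_bigI => b _.
by apply/seteqP; split=> v [Pv h]; split=> // b; [move=> _|]; exact: h.
Qed.

Lemma reducing_projection : separable_space V ->
  exists E : projection V,
  [/\ forall v, P (E v) = P v, forall v, E (P v) = P v,
      forall a v, E (pi a v) = pi a (E v) &
      (forall a, compact_op (P \bo pi a \bo P) -> P \bo pi a \bo P = 0) ->
      forall a, compact_op (E \bo pi a \bo E) -> E \bo pi a \bo E = 0].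
Proof.
move=> sV.
have N0 : null_space 0 by split=> [|b]; rewrite !bop0.
have NL c x y : null_space x -> null_space y -> null_space (c *: x + y).
  move=> [Px Nx] [Py Ny]; split=> [|b]; first by rewrite bopD bopZ Px Py scaler0 addr0.
  by rewrite !(bopD, bopZ) Nx Ny scaler0 addr0.
have [F FN] := closed_subspace_projection sV null_space_closed N0 NL.
have NF v : null_space (F v) by apply/FN; exact: projection_idemE.
have PF v : P (F v) = 0 by have [] := NF v.
have FP v : F (P v) = 0.
  by apply: ip_eq0P => w; rewrite !projection_fixed_adj PF ip0r.
have piN a v : null_space v -> null_space (pi a v).
  by move=> [_ Nv]; split=> [|b]; rewrite -?repME Nv.
have FpiF a v : F (pi a (F v)) = pi a (F v) by apply/FN/piN.
(* The null space is invariant under [pi a] and under [pi (star a)]; taking adjoints, [F] commutes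
   with [pi a]. *)
have Fpi a v : F (pi a v) = pi a (F v).
  apply: ip_ext => w; rewrite projection_fixed_adj repS -FpiF.
  by rewrite -projection_fixed_adj -repS -projection_fixed_adj FpiF.
have [E EE] : exists E : projection V, forall v, E v = v - F v.
  by exists (sub_proj (E := id_proj V) (P := F) (fun=> erefl) (fun=> erefl)).
exists E; split=> [v|v|a v|Pc].
- by rewrite EE bopB PF subr0.
- by rewrite EE FP subr0.
- by rewrite !EE Fpi bopB.
have Epi a v : E (pi a v) = pi a (E v) by rewrite !EE Fpi bopB.
have PE v : P (E v) = P v by rewrite EE bopB PF subr0.
have EP v : E (P v) = P v by rewrite EE FP subr0.
(* [P pi(a* a) P] factors through [E pi(a) E], so it is compact and vanishes; hence [pi a (P v)] has
   norm zero. *)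
have kill a : compact_op (E \bo pi a \bo E) -> forall v, pi a (P v) = 0.
  move=> ca v.
  have := compact_op_comp (P \bo pi (star a)) P ca.
  rewrite (_ : _ \bo _ = P \bo pi (amul (star a) a) \bo P); last first.
    by apply: bounded_op_ext => w /=; rewrite !EP Epi EP repME.
  move=> /Pc/(congr1 (fun T : bounded_op V V => T v))/= z.
  apply/eqP; rewrite -ip_eq0 (repS pi) projection_fixed_adj.
  by rewrite -repME z ip0r.
(* [kill] applies to [amul a b], because [E pi(ab) E = (E pi(a) E) pi(b)]. *)
have killM a : compact_op (E \bo pi a \bo E) -> forall b v, pi a (pi b (P v)) = 0.
  move=> ca b v; rewrite -repME; apply: kill.
  have := compact_op_comp op_id (pi b) ca.
  rewrite (_ : _ \bo _ = E \bo pi (amul a b) \bo E); first by [].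
  by apply: bounded_op_ext => w /=; rewrite repME -[pi b (E w)]Epi.
move=> a ca; apply: bounded_op_ext => v /=; apply: ip_eq0P => w.
rewrite !(projection_fixed_adj, repS pi).
(* By adjunction, [kill] and [killM] say that [pi (star a) (E w)] is orthogonal to all [P u] and
   [pi b (P u)], so that it lies in the null space, where [E] vanishes. *)
suff Nw : null_space (pi (star a) (E w)).
  by rewrite EE (FN _).2// subrr ip0r.
split=> [|b]; apply: ip_eq0P => u; rewrite projection_fixed_adj.
  by rewrite repS starK kill// ip0r.
by rewrite !repS starK killM// ip0r.
Qed.

End ReducingProjection.

(** * Restriction of a representation to a reducing subspace *)

Section SubRepresentation.
Context {R : realType} {V : hilbertType R} {B : cstarAlgType R}.
Variables (pi : star_rep B V) (E : projection V).
Hypothesis Epi : forall a v, E (pi a v) = pi a (E v).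

Let rep_fun a := compress E (pi a).

Let rep_fun_linear : linear rep_fun.
Proof.
move=> c a b; apply: bounded_op_ext => v; apply: val_inj.
rewrite /= rep_linear.
by rewrite -[X in E X]/(c *: pi a (val v) + pi b (val v)) bopD bopZ.
Qed.

Let rep_funM a b : rep_fun (amul a b) = rep_fun a \bo rep_fun b.
Proof.
apply: bounded_op_ext => v; apply: val_inj.
by rewrite /= repME [E (pi b (val v))]Epi proj_rangeE.
Qed.

Let rep_funS a : is_adjoint (rep_fun a) (rep_fun (star a)).
Proof.
move=> x y; rewrite -[LHS]/(ip (E (pi a (val x))) (val y)).
rewrite -[RHS]/(ip (val x) (E (pi (star a) (val y)))).
by rewrite projection_fixed_adj repS !Epi.
Qed.

Definition sub_rep : star_rep B (proj_range E) :=
  StarRep rep_fun_linear rep_funM rep_funS.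

End SubRepresentation.

(** * Gluing the ranges of [E - P] and [P] into the range of [E] *)

Section Recombination.
Context {R : realType} {V : hilbertType R} (P E : projection V).
Hypotheses (PE : forall v, P (E v) = P v) (EP : forall v, E (P v) = P v).

(** The projection of the candidate inverse plus the given extension. *)
Definition split_proj : projection (dsum (dsum V V) V) :=
  proj_dsum (proj_dsum E (sub_proj EP PE)) P.
Local Notation Q := split_proj.

Definition recombine (z : proj_range Q) : dsum (proj_range E) (proj_range E) :=
  (op_corestr E (val z).1.1, op_corestr E ((val z).1.2 + (val z).2)).

(** [op_corestr Q] cuts the two copies of [z.2] down to their parts in the ranges of [E - P] and
    [P]. *)
Definition distribute (z : dsum (proj_range E) (proj_range E)) : proj_range Q :=
  op_corestr Q ((((val z.1, val z.2) : dsum V V), val z.2) : dsum (dsum V V) V).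

Let Q1 (z : proj_range Q) : E (val z).1.1 = (val z).1.1.
Proof. by rewrite -[in RHS]proj_rangeE. Qed.

Let Q2 (z : proj_range Q) : E (val z).1.2 - P (val z).1.2 = (val z).1.2.
Proof. by rewrite -[in RHS]proj_rangeE. Qed.

Let Q3 (z : proj_range Q) : P (val z).2 = (val z).2.
Proof. by rewrite -[in RHS]proj_rangeE. Qed.

Let Q2E (z : proj_range Q) : E (val z).1.2 = (val z).1.2.
Proof. by rewrite -Q2 bopB projection_idemE EP. Qed.

Let Q2P (z : proj_range Q) : P (val z).1.2 = 0.
Proof. by rewrite -Q2 bopB projection_idemE PE subrr. Qed.

Let Q3E (z : proj_range Q) : E (val z).2 = (val z).2.
Proof. by rewrite -Q3 EP. Qed.

Lemma recombineK : cancel recombine distribute.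
Proof.
move=> z; apply: val_inj; apply: dsum_eq; first apply: dsum_eq.
- by rewrite /= projection_idemE Q1.
- rewrite -[LHS]/(E (E ((val z).1.2 + (val z).2)) - P (E ((val z).1.2 + (val z).2))).
  by rewrite projection_idemE PE !bopD Q2E Q2P Q3E Q3 add0r addrK.
- by rewrite /= PE bopD Q2P Q3 add0r.
Qed.

Lemma distributeK : cancel distribute recombine.
Proof.
move=> z; apply: dsum_eq; apply: val_inj.
  by rewrite /= projection_idemE proj_rangeE.
rewrite -[LHS]/(E (E (val z.2) - P (val z.2) + P (val z.2))).
by rewrite subrK projection_idemE proj_rangeE.
Qed.

Lemma recombine_adj u v : ip (recombine u) v = ip u (distribute v).
Proof.
rewrite -[LHS]/(ip (E (val u).1.1) (val v.1)
  + ip (E ((val u).1.2 + (val u).2)) (val v.2)).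
rewrite -[RHS]/(ip (val u).1.1 (E (val v.1))
  + ip (val u).1.2 (E (val v.2) - P (val v.2)) + ip (val u).2 (P (val v.2))).
rewrite !proj_rangeE ipBr -!projection_fixed_adj Q2P ip0l subr0.
by rewrite Q1 Q3 bopD Q2E Q3E ipDl addrA.
Qed.

(* Modulo the commutator with P, the operator T on the range of E is the sum of
   its compressions to the ranges of E - P and P. *)
Lemma recombine_compress (U : unitary (proj_range Q) (dsum (proj_range E) (proj_range E)))
  (T : bounded_op V V) : U =1 recombine -> unitary_adj U =1 distribute ->
  (forall v, E (T v) = T (E v)) ->
  compress Q (op_dsum (op_dsum T T) T)
    - (unitary_adj U \bo op_dsum (compress E T) (compress E T) \bo U) =
  ((op_corestr Q \bo op_inl \bo op_inr) \bo (- commutator T P) \bo (op_snd \bo op_incl Q)) +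
  ((op_corestr Q \bo op_inr) \bo commutator T P \bo (op_snd \bo op_fst \bo op_incl Q)).
Proof.
move=> Uf Ug ET; apply: bounded_op_ext => z; apply: val_inj.
have h1 := Q1 z; have e2 := Q2E z; have p2 := Q2P z; have h3 := Q3 z; have e3 := Q3E z.
set z1 := (val z).1.1 in h1 *; set z2 := (val z).1.2 in e2 p2 *.
set z3 := (val z).2 in h3 e3 *.
have e23 : E (z2 + z3) = z2 + z3 by rewrite bopD e2 e3.
(* Used for the component in [E - P], with [a], [b] coming from [z2] and [c], [d] from [z3]: the
   terms of [z2] cancel and the commutator at [z3] remains. *)
have sub4 a b c d : a - b - ((a + c) - (b + d)) = - (c - d) :> V.
  by rewrite [- (b + d)]opprD addrACA opprD addrA subrr add0r.
transitivity (val (compress Q (op_dsum (op_dsum T T) T) z)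
    - val (unitary_adj U (op_dsum (compress E T) (compress E T) (U z)))); first by [].
rewrite Uf Ug.
apply: dsum_eq; first apply: dsum_eq.
- rewrite -[LHS]/(E (T z1) - E (E (T (E z1)))) -[RHS]/(E 0 + E 0).
  by rewrite bop0 addr0 projection_idemE ET h1 ET h1 subrr.
- transitivity (E (T z2) - P (T z2)
    - (E (E (T (E (z2 + z3)))) - P (E (T (E (z2 + z3)))))); first by [].
  transitivity (E (- (T (P z3) - P (T z3))) - P (- (T (P z3) - P (T z3)))
    + (E 0 - P 0)); last by [].
  rewrite !bop0 subrr addr0 e23 projection_idemE PE h3.
  by rewrite !bopN !bopB projection_idemE EP !bopD subrr oppr0 subr0 sub4.
(* In the component in [P] only [- P (T z2)] survives, which is the commutator at [z2] because
   [P z2 = 0]. *)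
- rewrite -[LHS]/(P (T z3) - P (E (T (E (z2 + z3))))).
  rewrite -[RHS]/(P 0 + P (T (P z2) - P (T z2))).
  rewrite bop0 add0r e23 PE p2 !bop0 sub0r bopN projection_idemE.
  by rewrite !bopD opprD addrCA subrr addr0.
Qed.

End Recombination.

(** * The inverse of an extension *)

Section Inverse.
Context {R : realType} {H : hilbertType R} (K : frechet_ideal H).
Hypothesis hH : sid H.
Context {A : smooth_algebra R}.
Local Notation inc := (@smooth_incl R A).

(** The range of the identity projection is a copy of the whole space, identified with it by
    [val]. *)
Lemma cp_map_id (w : ext_pair A) : pair_proj w = op_id :> bounded_op _ _ ->
  cp_equiv K (smooth_cp w) (fun a => pair_rep w (inc a)).
Proof.
move=> w1; pose f (v : proj_range (pair_proj w)) : pair_space w := val v.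
apply: (@cp_equiv_conj _ _ _ _ _ _ _ _ f (op_corestr (pair_proj w))).
- by move=> x y; rewrite /= -[RHS]/(ip (val x) (pair_proj w y)) w1.
- by move=> x; apply: val_inj; rewrite /= proj_rangeE.
- by move=> x; rewrite -[LHS]/(pair_proj w x) w1.
- by move=> a x; apply: val_inj.
Qed.

Variable x : tau_extension K A.
Local Notation V := (pair_space x).
Local Notation P := (pair_proj x).
Local Notation pi := (pair_rep x).
Variable E : projection V.
Hypotheses (PE : forall v, P (E v) = P v) (EP : forall v, E (P v) = P v).
Hypothesis Epi : forall a v, E (pi a v) = pi a (E v).
Hypothesis Ec : forall a, compact_op (E \bo pi a \bo E) -> E \bo pi a \bo E = 0.

Let sV : sid V. Proof. by have [] := ext_smooth x. Qed.

Let sP : sid (proj_range P). Proof. exact: ext_sid. Qed.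

Let sE : sid (proj_range E).
Proof.
split; first exact: separable_range sV.1.
apply: (infinite_dimensional_surj (T := op_corestr P \bo op_incl E)) sP.2 => y.
have yE : val y \in range_pred E by rewrite unfold_in -[val y]proj_rangeE EP.
by exists (ProjRange E _ yE); apply: val_inj; rewrite /= proj_rangeE.
Qed.

Definition sub_pair : ext_pair A :=
  ExtPair (sub_rep Epi) (id_proj (proj_range E)).

Lemma sub_pair_smooth : tau_smooth K sub_pair.
Proof.
split=> //=.
- exact: (sid_range_id (P := id_proj _)).
- move=> a; apply/in_idealP => //.
  rewrite (_ : commutator _ _ = 0); first exact: ideal_factor0.
  by apply: bounded_op_ext => v; exact: subrr.
apply/(noncompactP sub_pair) => a ca.
have := compact_op_comp (op_incl E) (op_corestr E) ca.
rewrite (_ : _ \bo _ = E \bo pi a \bo E); last exact: bounded_op_ext.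
move=> /Ec/(congr1 (fun T : bounded_op V V => T : V -> V)) h.
apply: bounded_op_ext => v; apply: val_inj.
have := congr1 (fun T => T (val v)) h; rewrite /= proj_rangeE.
by [].
Qed.

Definition sub_ext : tau_extension K A := TauExtension sub_pair_smooth.

Definition inverse_pair : ext_pair A :=
  ExtPair (rep_dsum pi pi) (proj_dsum E (sub_proj EP PE)).

Lemma inverse_pair_smooth : tau_smooth K inverse_pair.
Proof.
have sVV := sid_dsum sV sV.1.
split=> //.
- exact: sid_range_proj_dsum sV.1 sV.1 sE.
- move=> a; apply/in_idealP => //.
  (* [E] commutes with [pi], so only the commutator with [P] is left, in the second summand and with
     a sign. *)
  rewrite (_ : commutator _ _ = - (op_inr \bo commutator (pi (inc a)) P \bo op_snd)).
    apply/ideal_factorN/ideal_factor_comp/(in_idealP K hH _ sV).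
    by have [] := ext_smooth x.
  apply: bounded_op_ext => v; apply: dsum_eq.
    rewrite -[LHS]/(pi (inc a) (E v.1) - E (pi (inc a) v.1)) -[RHS]/(- 0).
    by rewrite Epi subrr oppr0.
  rewrite -[LHS]/(pi (inc a) (E v.2 - P v.2) - (E (pi (inc a) v.2) - P (pi (inc a) v.2))).
  rewrite -[RHS]/(- (pi (inc a) (P v.2) - P (pi (inc a) v.2))).
  by rewrite Epi bopB !opprB [LHS]addrC addrA subrK.

apply/noncompactP => a ca.
(* Only the corner at [E] needs examining: once [E pi(a) E] vanishes, so does its further
   compression to [E - P]. *)
have := compact_op_comp op_fst op_inl ca.
rewrite (_ : _ \bo _ = E \bo pi a \bo E); last exact: bounded_op_ext.
move=> /Ec/(congr1 (fun T : bounded_op V V => T : V -> V)) h.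
have h0 v : E (pi a (E v)) = 0 by exact: (congr1 (fun T => T v) h).
apply: bounded_op_ext => v; apply: dsum_eq; first exact: h0.
pose w := E v.2 - P v.2.
have Ew : E (pi a w) = 0.
  by rewrite (_ : w = E w) ?h0// /w bopB projection_idemE EP.
rewrite -[LHS]/(E (pi a w) - P (pi a w)).
by rewrite Ew -(PE (pi a w)) Ew bop0 subrr.
Qed.

Definition inverse_ext : tau_extension K A := TauExtension inverse_pair_smooth.

(** Under the unitary given by [recombine], the difference is a sum of two operators factoring
    through the commutator of [pi(a)] and [P], which is in the ideal. *)
Lemma inverse_ext_sum : cp_equiv K (smooth_cp (pair_dsum inverse_ext x))
  (fun a => rep_dsum (sub_rep Epi) (sub_rep Epi) (inc a)).
Proof.
have [U [Uf Ug]] := unitary_of (@recombine_adj _ _ _ _ PE EP)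
  (@recombineK _ _ _ _ PE EP) (@distributeK _ _ _ _ PE EP).
exists U => a.
have CK : ideal_factor K (commutator (pi (inc a)) P).
  by apply/(in_idealP K hH _ sV); have [_ _ h _] := ext_smooth x; exact: h.
have sQ : sid (proj_range (split_proj PE EP)).
  have sVV := sid_dsum sV sV.1.
  apply: (@sid_range_proj_dsum _ _ _ (proj_dsum E (sub_proj EP PE)) P sVV.1 sV.1).
  exact: (@sid_range_proj_dsum _ _ _ E (sub_proj EP PE) sV.1 sV.1 sE).
have := recombine_compress Uf Ug (Epi (inc a)).
set S := (X in _ = X) => h.
suff : ideal_factor K S by rewrite -h.
by apply: ideal_factorD => //; apply: ideal_factor_comp => //; exact: ideal_factorN.
Qed.

(** The witness is the sum of two copies of [sub_ext], whose projection is the identity. *)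
Lemma inverse_ext_degenerate : degenerate K (ext_dsum inverse_ext x).
Proof.
exists (ext_dsum sub_ext sub_ext); split.
  by rewrite ext_dsumE//=; apply: bounded_op_ext => v; exact: dsum_eq.
rewrite !ext_dsumE//; apply/unitarily_equivalentP => //.
  by have := ext_sid (ext_dsum inverse_ext x); rewrite ext_dsumE.
apply: (cp_equiv_trans hH _ inverse_ext_sum).
  by have := ext_sid (ext_dsum inverse_ext x); rewrite ext_dsumE.
apply/cp_equiv_sym/cp_map_id; apply: bounded_op_ext => v; exact: dsum_eq.
Qed.

End Inverse.

Theorem inverse_exists (R : realType) (H : hilbertType R) (K : frechet_ideal H)
  (A : smooth_algebra R) (x : tau_extension K A) : sid H ->
  exists y : tau_extension K A, degenerate K (ext_dsum y x).
Proof.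
move=> hH; have [sV _ _ /noncompactP Pc] := ext_smooth x.
have [E [PE EP Epi Ec]] := reducing_projection (pair_rep x) (pair_proj x) sV.1.
by exists (inverse_ext hH PE EP Epi (Ec Pc)); exact: inverse_ext_degenerate.
Qed.

(** * Pull-back of extensions and functoriality *)

Section PullbackFunctor.
Context {R : realType} {H : hilbertType R} (K : frechet_ideal H).
Hypothesis hH : sid H.
Implicit Types A B C : smooth_algebra R.

(** On smooth elements [completion_ext f] is [f] itself; equivalences therefore pull back with the
    same unitary. *)
Lemma smooth_cp_pullback A B (f : smooth_hom B A) (p : ext_pair A) b :
  smooth_cp (pair_pullback f p) b = smooth_cp p (f b).
Proof. by rewrite /smooth_cp -completion_ext_incl. Qed.

Lemma ue_pullback A B (f : smooth_hom B A) (x y : tau_extension K A) :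
  unitarily_equivalent K x y ->
  unitarily_equivalent K (pullback f x) (pullback f y).
Proof.
move=> [U UK]; exists U => b.
have := UK (f b); rewrite -/(smooth_cp x (f b)) -/(smooth_cp y (f b)).
by rewrite -!smooth_cp_pullback.
Qed.

Lemma ue_pullback_dsum A B (f : smooth_hom B A) (x y : tau_extension K A) :
  unitarily_equivalent K (pullback f (ext_dsum x y))
    (ext_dsum (pullback f x) (pullback f y)).
Proof.
apply/(ueP hH); rewrite [ext_pair_of (pullback f (ext_dsum x y))]/= !ext_dsumE//.
by apply: (@cp_equiv_conj _ _ _ _ _ _ _ _ id id).
Qed.

Lemma degenerate_pullback A B (f : smooth_hom B A) (d : tau_extension K A) :
  degenerate K d -> degenerate K (pullback f d).
Proof.
by move=> [y [y1 dy]]; exists (pullback f y); split=> //; exact: ue_pullback.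
Qed.

Lemma stable_pullback A B (f : smooth_hom B A) (x y : tau_extension K A) :
  stably_equivalent x y -> stably_equivalent (pullback f x) (pullback f y).
Proof.
move=> /(stableP hH)[d [e [dd de xy]]]; apply/(stableP hH).
exists (pullback f d), (pullback f e); split; [exact: degenerate_pullback..|].
apply: (ue_trans hH (ue_sym hH (ue_pullback_dsum f x d))).
apply: (ue_trans hH _ (ue_pullback_dsum f y e)).
exact: ue_pullback.
Qed.

Lemma ext_pullback_class A B (f : smooth_hom B A) (x : tau_extension K A) :
  ext_pullback f (ext_class x) = ext_class (pullback f x).
Proof. by apply/(ext_class_eq hH)/stable_pullback/ext_class_repr. Qed.

Lemma ext_pullbackD A B (f : smooth_hom B A) (X Y : Ext K A) :
  ext_pullback f (ext_add X Y) = ext_add (ext_pullback f X) (ext_pullback f Y).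
Proof.
rewrite -(ext_reprK X) -(ext_reprK Y) ext_add_class// !ext_pullback_class ext_add_class//.
by apply/(ext_class_eq hH)/(stable_ue hH)/ue_pullback_dsum.
Qed.

Lemma ext_pullback_id A (X : Ext K A) : ext_pullback (smooth_id A) X = X.
Proof.
rewrite -(ext_reprK X) ext_pullback_class; apply/(ext_class_eq hH)/(stable_ue hH)/(ueP hH).
apply: (@cp_equiv_conj _ _ _ _ _ _ _ _ id id) => // a v.
by rewrite [ext_pair_of (pullback _ _)]/= smooth_cp_pullback.
Qed.

(** Equivalence only tests smooth elements, where both completely positive maps take the value at
    [f (g a)]; the extensions to the completions need not be composed. *)
Lemma ext_pullback_comp A B C (f : smooth_hom B A) (g : smooth_hom C B) (X : Ext K A) :
  ext_pullback (smooth_comp f g) X = ext_pullback g (ext_pullback f X).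
Proof.
rewrite -(ext_reprK X) !ext_pullback_class.
apply/(ext_class_eq hH)/(stable_ue hH)/(ueP hH).
apply: (@cp_equiv_conj _ _ _ _ _ _ _ _ id id) => // a v.
by rewrite ![ext_pair_of (pullback _ _)]/= !smooth_cp_pullback.
Qed.

End PullbackFunctor.

(** * The group structure and the functor *)

Lemma ext_abelian_group (R : realType) (H : hilbertType R) (K : frechet_ideal H)
  (A : smooth_algebra R) : sid H -> abelian_group (@ext_add R H K A).
Proof.
move=> hH; split.
- move=> X Y Z; rewrite -(ext_reprK X) -(ext_reprK Y) -(ext_reprK Z).
  rewrite !ext_add_class//; apply/(ext_class_eq hH)/(stable_ue hH).
  exact: ue_dsumA.
- move=> X Y; rewrite -(ext_reprK X) -(ext_reprK Y) !ext_add_class//.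
  by apply/(ext_class_eq hH)/(stable_ue hH); exact: ue_dsumC.
exists (ext_class (zero_ext K hH)) => X; rewrite -(ext_reprK X).
  rewrite ext_add_class//; apply/(ext_class_eq hH)/stable_dsum0 => //.
  exact: degenerate_zero.
(* The sum with [y] is degenerate, and all degenerate extensions are identified with the zero
   extension. *)
have [y yd] := inverse_exists (ext_repr X) hH.
exists (ext_class y); rewrite ext_add_class//; apply/(ext_class_eq hH).
by apply: stable_degenerate => //; exact: degenerate_zero.
Qed.

Theorem mainTheorem4 (R : realType) (H : hilbertType R)
    (hH : separable_infinite_dimensional H) (K : frechet_ideal H) :
  (* Ext_tau is well defined on objects and takes its values in abelian groups *)
  (forall A : smooth_algebra R, separable_space A ->
     [/\ forall x y : tau_extension K A, tau_smooth K (pair_dsum x y),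
         forall x y : tau_extension K A,
           ext_class x = ext_class y <-> stably_equivalent x y,
         forall x y : tau_extension K A,
           ext_add (ext_class x) (ext_class y) = ext_class (ext_dsum x y) &
         abelian_group (@ext_add R H K A)]) /\
  (* morphisms induce group homomorphisms, by pull-back of extensions *)
  (forall (A B : smooth_algebra R) (f : smooth_hom B A),
     separable_space A -> separable_space B ->
     (forall x : tau_extension K A,
        ext_pullback f (ext_class x) = ext_class (pullback f x)) /\
     (forall X Y : Ext K A,
        ext_pullback f (ext_add X Y)
          = ext_add (ext_pullback f X) (ext_pullback f Y))) /\
  (* contravariant functoriality *)
  (forall A : smooth_algebra R, separable_space A ->
     forall X : Ext K A, ext_pullback (smooth_id A) X = X) /\
  (forall (A B C : smooth_algebra R) (f : smooth_hom B A) (g : smooth_hom C B),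
     separable_space A -> separable_space B -> separable_space C ->
     forall X : Ext K A,
       ext_pullback (smooth_comp f g) X = ext_pullback g (ext_pullback f X)).
Proof.
split=> [A _|].
  split.
  - by move=> x y; apply: pair_dsum_smooth => //; exact: ext_smooth.
  - by move=> x y; exact: ext_class_eq.
  - by move=> x y; exact: ext_add_class.
  - exact: ext_abelian_group.
split=> [A B f _ _|].
  by split=> [x|X Y]; [exact: ext_pullback_class|exact: ext_pullbackD].
split=> [A _ X|A B C f g _ _ _ X]; first exact: ext_pullback_id.
exact: ext_pullback_comp.
Qed.
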